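(* For each $n\ge1$ there exists $\varepsilon=\varepsilon(n)>0$ such that if $\Gamma$ is an infinite, finitely generated group that is not virtually cyclic and that contains a nilpotent subgroup of index at most $n$, and $S$ is any finite generating set of $\Gamma$, then $p_c(\operatorname{Cay}(\Gamma,S))\le1-\varepsilon$.
   Context: $\operatorname{Cay}(\Gamma,S)$ has vertex set $\Gamma$ and edges $\{x,y\}$ with $x=ys$, $s\in S\cup S^{-1}\setminus\{\mathrm{id}\}$. For an infinite connected locally finite graph $G$, $p_c(G)=\sup\{p:\text{every cluster of Bernoulli-}p\text{ bond percolation is finite a.s.}\}$, where Bernoulli-$p$ bond percolation keeps each edge independently with probability $p$. Note that $\varepsilon$ does not depend on $|S|$. *)

(* Defs.v *)
From HB Require Import structures.
From mathcomp Require Import all_boot all_order all_algebra.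
From mathcomp Require Import all_classical all_reals all_analysis.
From mathcomp Require Import Rstruct.
Set Implicit Arguments. Unset Strict Implicit. Unset Printing Implicit Defensive.
Import Order.TTheory GRing.Theory Num.Theory.

Record group_struct (G : Type) := GroupStruct {
  gmul : G -> G -> G;
  ginv : G -> G;
  gone : G;
  gmulA : forall x y z, gmul x (gmul y z) = gmul (gmul x y) z;
  gmul1x : forall x, gmul gone x = x;
  gmulx1 : forall x, gmul x gone = x;
  gmulVx : forall x, gmul (ginv x) x = gone;
  gmulxV : forall x, gmul x (ginv x) = gone }.

Section Groups.
Variables (G : Type) (g : group_struct G).
Local Notation "x * y" := (gmul g x y).
Local Notation "x ^-1" := (ginv g x).
Local Notation "1" := (gone g).

Definition is_subgroup (H : G -> Prop) : Prop :=
  H 1 /\ (forall x y, H x -> H y -> H (x * y)) /\ (forall x, H x -> H (x^-1)).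

Definition gen (A : G -> Prop) (x : G) : Prop :=
  forall K, is_subgroup K -> (forall a, A a -> K a) -> K x.

Definition gcomm (a b : G) : G := a^-1 * b^-1 * a * b.

Fixpoint lcs (H : G -> Prop) (i : nat) : G -> Prop :=
  match i with
  | 0 => H
  | i.+1 => gen (fun c => exists a b, lcs H i a /\ H b /\ c = gcomm a b)
  end.

Definition nilpotent (H : G -> Prop) : Prop :=
  exists c, forall x, lcs H c x -> x = 1.

Definition index_le (H : G -> Prop) (n : nat) : Prop :=
  exists L : seq G, size L <= n /\
    forall x, exists t, List.In t L /\ H (t^-1 * x).

Definition finite_index (H : G -> Prop) : Prop := exists n, index_le H n.

Fixpoint gpow (x : G) (k : nat) : G :=
  match k with 0 => 1 | k.+1 => x * gpow x k end.

Definition cyc (x : G) (y : G) : Prop :=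
  exists k, y = gpow x k \/ y = (gpow x k)^-1.

Definition virtually_cyclic : Prop := exists x, finite_index (cyc x).

Definition infinite_group : Prop := ~ exists L : seq G, forall x, List.In x L.

Definition generates (S : seq G) : Prop := forall x, gen (fun s => List.In s S) x.

Definition cay_adj (S : seq G) (x y : G) : Prop :=
  exists s, (List.In s S \/ List.In (s^-1) S) /\ s <> 1 /\ x = y * s.

Inductive reach (E : G -> G -> Prop) (x : G) : G -> Prop :=
  | reach_refl : reach E x x
  | reach_step : forall y z, reach E x y -> E y z -> reach E x z.

Definition cluster_finite (E : G -> G -> Prop) (x : G) : Prop :=
  exists L : seq G, forall y, reach E x y -> List.In y L.

End Groups.

Local Open Scope ring_scope.
Local Open Scope classical_set_scope.

(* Edge variables X x y (x ~ y) on a probability space: symmetric in the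
   endpoints (one variable per unordered edge), measurable, and the joint law
   of any finitely many distinct edges is the product Bernoulli(p) law. *)
Definition bernoulli_bond_perc (G : Type) (g : group_struct G) (S : seq G)
  (p : Rdefinitions.R) (d : measure_display) (T : measurableType d) (P : probability T Rdefinitions.R)
  (X : G -> G -> T -> bool) : Prop :=
  (forall x y w, X x y w = X y x w) /\
  (forall x y, measurable [set w : T | X x y w]) /\
  (forall (es : seq (G * G)) (bs : seq bool),
     size es = size bs ->
     (forall i, (i < size es)%N ->
        cay_adj g S (nth (gone g, gone g) es i).1 (nth (gone g, gone g) es i).2) ->
     (forall i j, (i < size es)%N -> (j < size es)%N -> i <> j ->
        nth (gone g, gone g) es i <> nth (gone g, gone g) es j /\
        nth (gone g, gone g) es i <>
          ((nth (gone g, gone g) es j).2, (nth (gone g, gone g) es j).1)) ->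
     P [set w : T | forall i, (i < size es)%N ->
                  X (nth (gone g, gone g) es i).1 (nth (gone g, gone g) es i).2 w
                  = nth false bs i]
     = (\prod_(b <- bs) (if b then p else 1 - p))%:E).

Definition open_edge (G : Type) (g : group_struct G) (S : seq G)
  (T : Type) (X : G -> G -> T -> bool) (w : T) (x y : G) : Prop :=
  cay_adj g S x y /\ X x y w.

Definition all_clusters_finite_as (G : Type) (g : group_struct G) (S : seq G)
  (d : measure_display) (T : measurableType d) (P : probability T Rdefinitions.R)
  (X : G -> G -> T -> bool) : Prop :=
  exists N : set T, measurable N /\ P N = 0%E /\
    forall w, ~ N w -> forall x, cluster_finite (open_edge g S X w) x.

(* Main.v *)
Require Import Defs.
From HB Require Import structures.
From mathcomp Require Import all_boot all_order all_algebra.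
From mathcomp Require Import all_classical all_reals all_analysis.
From mathcomp Require Import Rstruct.
From mathcomp Require Import zify ring lra.
Import Order.TTheory GRing.Theory Num.Theory.
Set Implicit Arguments. Unset Strict Implicit. Unset Printing Implicit Defensive.
Local Open Scope ring_scope.

(** Let [H] be the nilpotent subgroup and [K = [H, H]].  By Schreier's lemma [H]
    is generated by words of length less than [2n] in [S], and two of these, [x]
    and [y], are independent modulo [K]: otherwise [H / K] is virtually cyclic,
    which makes every later quotient of the lower central series finitely
    generated torsion, hence finite, and the whole group virtually cyclic.

    The points [K x^a y^b] form a quadrant of the square grid inside the Schreier
    graph [K \ Gamma], neighbours being joined by paths of fewer than [2n] edges,
    and an edge lies on boundedly many of these paths.  Call a grid point bad if
    an edge of one of its two outgoing paths is closed, and a box of side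
    [3^(k+1)] bad if two of its nine subboxes are bad.  A bad box of side [3^k]
    contains [2^k] bad points in one of [C^(2^k)] patterns, so it has probability
    at most [4^-(2^k)] when [1 - p] is small in terms of [n] only.  Good boxes are
    connected to their good neighbours, because a 3x3 square minus a cell is
    connected, so in the Schreier graph the origin is joined to points
    arbitrarily far away with probability at least 1/2.

    Self-avoiding paths of the Schreier graph lift to [Gamma], and giving the lifts
    of an edge independent states only helps (McDiarmid's clutter theorem); hence
    the cluster of the identity is infinite with positive probability. *)

Declare Scope grp_scope.
Delimit Scope grp_scope with grp.

(** * Group theory *)

Section GroupTheory.
Variables (G : Type) (g : group_struct G).
Local Notation "x * y" := (gmul g x y) : grp_scope.
Local Notation "x ^-1" := (ginv g x) : grp_scope.
Local Notation "1" := (gone g) : grp_scope.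
Local Notation "x ^+ k" := (gpow g x k) : grp_scope.
Local Open Scope grp_scope.
Implicit Types (x y z u v a b c h t : G) (A H K Q : G -> Prop).

Lemma gmulK x y : x * y * y^-1 = x.
Proof. by rewrite -gmulA gmulxV gmulx1. Qed.

Lemma gmulVK x y : x * y^-1 * y = x.
Proof. by rewrite -gmulA gmulVx gmulx1. Qed.

Lemma ginv_unique x y : x * y = 1 -> y = x^-1.
Proof. by move=> h; rewrite -(gmul1x g y) -(gmulVx g x) -gmulA h gmulx1. Qed.

Lemma ginvK x : x^-1^-1 = x.
Proof. by symmetry; apply: ginv_unique; rewrite gmulVx. Qed.

Lemma ginv1 : 1^-1 = 1 :> G.
Proof. by symmetry; apply: ginv_unique; rewrite gmul1x. Qed.

Lemma ginvM x y : (x * y)^-1 = y^-1 * x^-1.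
Proof. by symmetry; apply: ginv_unique; rewrite !gmulA gmulK gmulxV. Qed.

(* Normalises words of the free group. *)
Definition gE := (ginvM, ginvK, ginv1, gmulA, gmulx1, gmul1x, gmulVK, gmulK, gmulVx, gmulxV).

Lemma gmul_injl x y z : x * z = y * z -> x = y.
Proof. by move=> h; rewrite -(gmulK x z) h gmulK. Qed.

Lemma gpowD x k l : x ^+ (k + l) = x ^+ k * x ^+ l.
Proof. by elim: k => [|k IH]; rewrite ?gE // addSn /= IH gmulA. Qed.

Lemma gpowSr x k : x ^+ k.+1 = x ^+ k * x.
Proof. by rewrite -addn1 gpowD /= gmulx1. Qed.

Lemma gpowM x k l : x ^+ (k * l)%N = (x ^+ k) ^+ l.
Proof. by elim: l => [|l IH]; rewrite ?muln0 // mulnS gpowD IH. Qed.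

Lemma gpowB x k l : (l <= k)%N -> x ^+ (k - l) = x ^+ k * (x ^+ l)^-1.
Proof. by move=> lk; rewrite -{2}(subnK lk) gpowD gE. Qed.

Section Subgroup.
Variables (H : G -> Prop) (sH : is_subgroup g H).
Lemma sub1 : H 1. Proof. by case: sH. Qed.
Lemma subM x y : H x -> H y -> H (x * y). Proof. by case: sH => _ [h _]; apply: h. Qed.
Lemma subV x : H x -> H (x^-1). Proof. by case: sH => _ [_ h]; apply: h. Qed.
Lemma subX x k : H x -> H (x ^+ k).
Proof. by move=> hx; elim: k => [|k IH] /=; [apply: sub1 | apply: subM]. Qed.
Lemma subVr x : H (x^-1) -> H x. Proof. by move=> /subV; rewrite gE. Qed.
Lemma subMr x y : H y -> H (x * y) -> H x.
Proof. by move=> hy hxy; have := subM hxy (subV hy); rewrite !gE. Qed.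
Lemma subR x y : H x -> H y -> H (gcomm g x y).
Proof. by move=> hx hy; rewrite /gcomm; do !apply: subM => //; apply: subV. Qed.
End Subgroup.

Lemma gen_subgroup A : is_subgroup g (gen g A).
Proof.
split; first by move=> K sK _; apply: sub1.
split=> [x y hx hy K sK AK|x hx K sK AK]; first by apply: subM; [|apply: hx|apply: hy].
by apply: subV => //; apply: hx.
Qed.

Lemma gen_in A x : A x -> gen g A x.
Proof. by move=> Ax K _; apply. Qed.

Lemma cyc_subgroup x : is_subgroup g (cyc g x).
Proof.
have mx y : cyc g x y -> cyc g x (x * y).
  move=> [k [->|->]]; first by exists k.+1; left.
  case: k => [|k]; first by exists 1%N; left; rewrite /= !gE.
  by exists k; right; rewrite gpowSr !gE.
have mV y : cyc g x y -> cyc g x (x^-1 * y).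
  move=> [[|k] [->|->]]; first by exists 1%N; right; rewrite /= !gE.
  - by exists 1%N; right; rewrite /= !gE.
  - by exists k; left; rewrite /= !gE.
  - by exists k.+2; right; rewrite (gpowSr x k.+1) !gE.
split; first by exists 0%N; left.
split=> [y z [k [->|->]] cz|y [k [->|->]]].
- by elim: k => [|k IH] /=; [rewrite gmul1x | rewrite -gmulA; apply: mx].
- elim: k => [|k IH]; first by rewrite /= !gE.
  by rewrite gpowSr ginvM -gmulA; apply: mV.
- by exists k; right.
- by exists k; left; rewrite gE.
Qed.

(** * Commutator calculus modulo the next term of the lower central series *)

Section LowerCentral.
Variables (H : G -> Prop) (sH : is_subgroup g H).
Local Notation L := (lcs g H).

Lemma lcs_subgroup i : is_subgroup g (L i).
Proof. by case: i => //= i; apply: gen_subgroup. Qed.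

Lemma lcs_comm i a b : L i a -> H b -> L i.+1 (gcomm g a b).
Proof. by move=> ha hb; apply: gen_in; exists a, b. Qed.

Lemma lcs_sub_conj i : (forall a, L i a -> H a) /\ (forall a b, L i a -> H b -> L i (b^-1 * a * b)).
Proof.
elim: i => [|i [IH1 IH2]].
  by split=> // a b ha hb; do !apply: subM => //; apply: subV.
split=> a.
  by apply => // _ [a' [b' [/IH1 ha [hb ->]]]]; apply: subR.
move=> b ha; move: b.
apply: (ha (fun a => forall b, H b -> L i.+1 (b^-1 * a * b))).
  split=> [b hb|]; first by rewrite !gE; apply: sub1; apply: lcs_subgroup.
  split=> [x y hx hy b hb|x hx b hb].
    have := subM (lcs_subgroup i.+1) (hx b hb) (hy b hb); by rewrite !gE.
  by have := subV (lcs_subgroup i.+1) (hx b hb); rewrite !gE.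
move=> _ [x [y [hx [hy ->]]]] b hb.
have := lcs_comm (IH2 x b hx hb) (subM sH (subM sH (subV sH hb) hy) hb).
by rewrite /gcomm !gE.
Qed.

Lemma lcs_H i a : L i a -> H a.
Proof. by case: (lcs_sub_conj i) => h _; apply: h. Qed.

Lemma lcs_conj i a b : L i a -> H b -> L i (b^-1 * a * b).
Proof. by case: (lcs_sub_conj i) => _; apply. Qed.

Lemma lcs_conjV i a b : L i a -> H b -> L i (b * a * b^-1).
Proof. by move=> ha /(subV sH) hb; have := lcs_conj ha hb; rewrite gE. Qed.

Lemma lcs_S i a : L i.+1 a -> L i a.
Proof.
move=> ha; apply: (ha (L i)); first exact: lcs_subgroup.
move=> _ [x [y [hx [hy ->]]]]; rewrite /gcomm -!gmulA; apply: subM; first exact: lcs_subgroup.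
  by apply: subV => //; apply: lcs_subgroup.
by rewrite gmulA; apply: lcs_conj.
Qed.

Lemma gcommMl a b c : gcomm g (a * b) c = gcomm g a c * gcomm g (gcomm g a c) b * gcomm g b c.
Proof. by rewrite /gcomm !gE. Qed.

Lemma gcommMr a b c : gcomm g a (b * c) = gcomm g a c * (gcomm g a b * gcomm g (gcomm g a b) c).
Proof. by rewrite /gcomm !gE. Qed.

(** Modulo [L i.+2] the commutator is multiplicative in each argument, because the error terms are
    double commutators. So generators suffice: first the right argument is extended from [F0] to
    [H], then the left one from [F] to [L i]. *)
Lemma lcs_comm_gen i (F F0 : seq G) :
  (forall h, H h -> gen g (fun u => List.In u F0) h) ->
  (forall t, List.In t F -> L i t) -> (forall s, List.In s F0 -> H s) ->
  (forall u, L i u -> gen g (fun x => List.In x F \/ L i.+1 x) u) ->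
  forall u, L i.+1 u ->
    gen g (fun x => (exists t s, List.In t F /\ List.In s F0 /\ x = gcomm g t s) \/ L i.+2 x) u.
Proof.
move=> genH FL F0H genF.
set J := gen g (fun x => (exists t s, _) \/ _).
have sJ : is_subgroup g J by apply: gen_subgroup.
have JL u : L i.+2 u -> J u by move=> hu; apply: gen_in; right.
have J2 a b c : L i a -> H b -> H c -> J (gcomm g (gcomm g a b) c).
  by move=> ha hb hc; apply: JL; apply: lcs_comm => //; apply: lcs_comm.
have Jt t b : List.In t F -> H b -> J (gcomm g t b).
  move=> tF hb; have hb' := hb; apply genH in hb'.
  suff [] : H b /\ J (gcomm g t b) by [].
  apply: (hb' (fun b => H b /\ J (gcomm g t b))) => [|s sF]; last first.
    by split; [apply: F0H | apply: gen_in; left; exists t, s].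
  split; first by split; [apply: sub1 | rewrite /gcomm !gE; apply: sub1].
  split=> [x y [hx Jx] [hy Jy]|x [hx Jx]].
    split; first exact: subM.
    rewrite gcommMr; apply: (subM sJ) => //; apply: (subM sJ) => //.
    by apply: J2 => //; apply: FL.
  split; first exact: subV.
  (* Expanding [gcomm g t (x * x^-1) = 1] shows that this product is the inverse of
     [gcomm g t x^-1]. *)
  have : J (gcomm g t x * gcomm g (gcomm g t x) x^-1).
    by apply: (subM sJ) => //; apply: J2 => //; [apply: FL | apply: (subV sH)].
  by move/(subV sJ); rewrite /gcomm !gE.
move=> u; apply=> // _ [a [b [ha [hb ->]]]].
move: b hb; have := genF _ ha.
suff S : forall a, gen g (fun x => List.In x F \/ L i.+1 x) a ->
    L i a /\ forall b, H b -> J (gcomm g a b).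
  by move/S => [].
move=> a' ga'; apply: (ga' (fun a => L i a /\ forall b, H b -> J (gcomm g a b))).
  split.
    split; first by apply: sub1; apply: lcs_subgroup.
    by move=> b hb; rewrite /gcomm !gE; apply: sub1.
  split=> [x y [hx Jx] [hy Jy]|x [hx Jx]].
    split; first by apply: (subM (lcs_subgroup i)).
    move=> b hb; rewrite gcommMl; apply: (subM sJ) => //; last exact: Jy.
    by apply: (subM sJ) => //; [apply: Jx | apply: J2 => //; apply: lcs_H hy].
  split; first by apply: (subV (lcs_subgroup i)).
  move=> b hb; have hx' := lcs_H hx.
  have : J (gcomm g x b * gcomm g (gcomm g x b) x^-1).
    by apply: (subM sJ) => //; [apply: Jx | apply: J2 => //; apply: (subV sH)].
  by move/(subV sJ); rewrite /gcomm !gE.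
move=> x [xF|hx]; first by split; [apply: FL | move=> b; apply: Jt].
by split; [apply: lcs_S | move=> b hb; apply: JL; apply: lcs_comm].
Qed.

Lemma gcomm_powl i a b k : L i a -> H b ->
  L i.+2 ((gcomm g a b ^+ k)^-1 * gcomm g (a ^+ k) b).
Proof.
move=> ha hb; have sL := lcs_subgroup i.+2.
have hH := lcs_H ha.
elim: k => [|k IH]; first by rewrite /gcomm /= !gE; apply: sub1.
have h1 : L i.+2 (gcomm g (gcomm g a b) (a ^+ k)).
  by apply: lcs_comm; [apply: lcs_comm | apply: subX].
have hc : H (gcomm g a b) by apply: lcs_H (lcs_comm ha hb).
have h2 := subM sL (lcs_conj h1 (subX sH k hc)) IH.
by move: h2; rewrite -[gcomm g (a ^+ k.+1) b]/(gcomm g (a * a ^+ k) b) gcommMl /= !gE.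
Qed.

Lemma gcomm_powr i a b k : L i a -> H b ->
  L i.+2 ((gcomm g a b ^+ k)^-1 * gcomm g a (b ^+ k)).
Proof.
move=> ha hb; have sL := lcs_subgroup i.+2.
elim: k => [|k IH]; first by rewrite /gcomm /= !gE; apply: sub1.
have h1 : L i.+2 (gcomm g (gcomm g a b) (b ^+ k)).
  by apply: lcs_comm; [apply: lcs_comm | apply: subX].
have hc : H (gcomm g a b) by apply: lcs_H (lcs_comm ha hb).
rewrite -[b ^+ k.+1]/(b * b ^+ k) gcommMr gpowSr.
have := subM sL (lcs_conj IH hc) h1.
by rewrite !gE.
Qed.

(** Since [L i.+2] is normal in [H], congruent elements have congruent powers; this moves a torsion
    relation from [v] to [u]. *)
Lemma pow_congr i u v m : L i.+1 u -> L i.+1 v -> L i.+2 (u^-1 * v) ->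
  L i.+2 (v ^+ m) -> L i.+2 (u ^+ m).
Proof.
move=> hu hv huv; have sL := lcs_subgroup i.+2.
have uH := lcs_H hu; have vH := lcs_H hv.
suff h : L i.+2 ((u ^+ m)^-1 * v ^+ m).
  by move=> hm; apply: (subVr sL); apply: (subMr sL hm).
elim: m => [|m IH]; first by rewrite /= !gE; apply: sub1.
have := subM sL (lcs_conj huv (subX sH m uH)) IH.
by rewrite /= !gE.
Qed.

End LowerCentral.

(** * Finite covers by left cosets, and finiteness of torsion abelian quotients *)

Definition fin_mod (A K : G -> Prop) : Prop :=
  exists L : seq G, forall u, A u -> exists t, List.In t L /\ K (t^-1 * u).

Lemma fin_mod_trans A K Q : fin_mod A K -> fin_mod K Q -> fin_mod A Q.
Proof.
move=> [L1 h1] [L2 h2]; exists (List.map (fun d => d.1 * d.2) (List.list_prod L1 L2)).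
move=> u /h1[t [tL /h2[t' [tL' h]]]]; exists (t * t'); split; last by rewrite ginvM -gmulA.
by apply/List.in_map_iff; exists (t, t'); split => //; apply/List.in_prod.
Qed.

(** Modulo [K] the group [Q] is abelian and the elements of [F] are torsion, so [F] generates a
    finite group: splitting off [f], every element is [f ^+ j * v] with [j] at most [m] and [v]
    generated by the rest. *)
Lemma fin_mod_gen Q K (F : seq G) : is_subgroup g Q -> is_subgroup g K ->
  (forall u, K u -> Q u) -> (forall u v, Q u -> Q v -> K (gcomm g u v)) ->
  (forall t, List.In t F -> Q t /\ exists m, K (t ^+ m.+1)) ->
  fin_mod (gen g (fun x => List.In x F \/ K x)) K.
Proof.
move=> sQ sK KQ QQ; elim: F => [|f F IH] hF.
  exists [:: 1] => u hu; exists 1; split; first by left.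
  by rewrite !gE; apply: hu => // a [].
have [|L hL] := IH; first by move=> t tF; apply: hF; right.
have [Qf [m Km]] := hF f (or_introl erefl).
set J := gen g (fun x => List.In x F \/ K x) in hL.
have sJ : is_subgroup g J by apply: gen_subgroup.
have KJ u : K u -> J u by move=> ku; apply: gen_in; right.
have JQ u : J u -> Q u.
  by apply => // x [xF|/KQ //]; have [] : Q x /\ _ := hF x (or_intror xF).
exists (List.map (fun d => f ^+ d.1 * d.2) (List.list_prod (List.seq 0 m.+1) L)) => u hu.
suff [j [v [jm Jv ->]]] : exists j v, [/\ (j < m.+1)%N, J v & u = f ^+ j * v].
  have [t [tL Kt]] := hL v Jv.
  exists (f ^+ j * t); split; last by rewrite !gE.
  apply/List.in_map_iff; exists (j, t); split => //; apply/List.in_prod => //.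
  by apply/List.in_seq; split; apply/ssrnat.leP.
suff [_ [j [v [Jv ->]]]] : Q u /\ exists j v, J v /\ u = f ^+ j * v.
  (* The power of [f] with exponent a multiple of [m.+1] lies in [K] and is absorbed into [v]. *)
  exists (j %% m.+1)%N, (f ^+ (m.+1 * (j %/ m.+1))%N * v); split.
  - by rewrite ltn_mod.
  - by apply: (subM sJ) => //; apply: KJ; rewrite gpowM; apply: subX.
  - by rewrite gmulA -gpowD addnC mulnC -divn_eq.
apply: (hu (fun u => Q u /\ exists j v, J v /\ u = f ^+ j * v)); last first.
  move=> a [[<-|aF]|Ka].
  - by split=> //; exists 1%N, 1; split; [apply: sub1 | rewrite /= !gE].
  - split; first by have [] : Q a /\ _ := hF a (or_intror aF).
    by exists 0%N, a; split; [apply: gen_in; left | rewrite /= !gE].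
  - by split; [apply: KQ | exists 0%N, a; split; [apply: KJ | rewrite /= !gE]].
split; first by split; [apply: sub1 | exists 0%N, 1; split; [apply: sub1 | rewrite /= !gE]].
split=> [x y [Qx [j [v [Jv ex]]]] [Qy [l [w [Jw ey]]]]|x [Qx [j [v [Jv ex]]]]].
  split; first exact: (subM sQ).
  exists (j + l)%N, (v * gcomm g v (f ^+ l) * w); split.
    apply: (subM sJ) => //; apply: (subM sJ) => //; apply: KJ; apply: QQ; first exact: JQ.
    exact: (subX sQ).
  by rewrite ex ey gpowD /gcomm !gE.
split; first exact: (subV sQ).
(* Exponents are natural numbers, so the inverse of [f ^+ j] is written as [f ^+ (m * j)] times the
   inverse of [f ^+ (m.+1 * j)], which lies in [K]; the commutator restores the order of the
   factors. *)
exists (m * j)%N, ((f ^+ (m.+1 * j)%N)^-1 * v^-1 * gcomm g v^-1 (f ^+ j)^-1); split.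
  apply: (subM sJ); first apply: (subM sJ).
  - by apply: (subV sJ); apply: KJ; rewrite gpowM; apply: subX.
  - exact: (subV sJ).
  - by apply: KJ; apply: QQ; [apply: (subV sQ); apply: JQ | apply: (subV sQ); apply: subX].
by rewrite ex mulSn gpowD /gcomm !gE.
Qed.

(** * Virtual cyclicity from a virtually cyclic abelianization *)

Section VirtuallyCyclic.
Variables (H : G -> Prop) (sH : is_subgroup g H) (F0 : seq G) (x : G).
Local Notation L := (lcs g H).
Hypotheses (F0H : forall s, List.In s F0 -> H s)
  (genH : forall h, H h -> gen g (fun u => List.In u F0) h) (Hx : H x).

(** The subgroup generated by [x] and [[H, H]]. *)
Definition cycL (u : G) : Prop := exists z c, [/\ cyc g x z, L 1 c & u = z * c].

Hypothesis torF0 : forall s, List.In s F0 -> exists m, cycL (s ^+ m.+1).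

Lemma cyc_H z : cyc g x z -> H z.
Proof. by case=> k [->|->]; [|apply: (subV sH)]; apply: subX. Qed.

Lemma cycL_subgroup : is_subgroup g cycL.
Proof.
have sC := cyc_subgroup x; have sL := lcs_subgroup sH 1.
split; first by exists 1, 1; split; [apply: sub1 | apply: sub1 | rewrite gE].
split=> [_ _ [z [c [hz hc ->]]] [z' [c' [hz' hc' ->]]]|_ [z [c [hz hc ->]]]].
  exists (z * z'), (z'^-1 * c * z' * c'); split; first exact: (subM sC).
    by apply: (subM sL) => //; apply: lcs_conj => //; apply: cyc_H.
  by rewrite !gE.
exists z^-1, (z * c^-1 * z^-1); split; first exact: (subV sC).
  by apply: lcs_conjV => //; [apply: (subV sL) | apply: cyc_H].
by rewrite !gE.
Qed.

Lemma cyc_comm z z' : cyc g x z -> cyc g x z' -> z * z' = z' * z.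
Proof.
have c1 k l : x ^+ k * x ^+ l = x ^+ l * x ^+ k by rewrite -!gpowD addnC.
have c2 u v : u * v = v * u -> u * v^-1 = v^-1 * u.
  by move=> h; apply: (@gmul_injl _ _ v); rewrite gE -gmulA h gmulA !gE.
have c2' u v : u * v = v * u -> u^-1 * v = v * u^-1 by move=> h; symmetry; apply: c2.
case=> k [->|->] [l [->|->]] //; [exact: c2|exact: c2'|].
by apply: c2; apply: c2'.
Qed.

(** Powers of [x] commute, so expanding the commutator leaves only factors with an argument in
    [L 1]. *)
Lemma cycL_comm u v : cycL u -> cycL v -> L 2 (gcomm g u v).
Proof.
move=> [z [c [hz hc ->]]] [z' [c' [hz' hc' ->]]].
have sL := lcs_subgroup sH 2; have sL1 := lcs_subgroup sH 1.
have Hz := cyc_H hz; have Hz' := cyc_H hz'.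
have Hc := lcs_H sH hc; have Hc' := lcs_H sH hc'.
have e : gcomm g z z' = 1 by rewrite /gcomm -gmulA (cyc_comm hz hz') !gE.
have h1 : L 2 (gcomm g z c').
  by apply: (subVr sL); have := lcs_comm hc' Hz; rewrite /gcomm !gE.
have h2 : L 2 (gcomm g z (z' * c')).
  rewrite gcommMr e; apply: (subM sL) => //.
  by rewrite /gcomm !gE; apply: sub1.
rewrite gcommMl; apply: (subM sL); first apply: (subM sL) => //.
  by apply: lcs_comm => //; apply: lcs_S.
by apply: lcs_comm => //; apply: (subM sH).
Qed.

Fixpoint lcs_gens (i : nat) : seq G :=
  if i is i'.+1 then [seq gcomm g t s | t <- lcs_gens i', s <- F0] else F0.

Lemma in_comms u (F F' : seq G) : List.In u [seq gcomm g t s | t <- F, s <- F'] <->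
  exists t s, List.In t F /\ List.In s F' /\ u = gcomm g t s.
Proof.
elim: F => [|t F IH] /=; first by split=> // -[t [s []]].
rewrite List.in_app_iff IH; split.
  case=> [/List.in_map_iff[s [<- sF]]|[t' [s [h1 [h2 h3]]]]].
    by exists t, s; split; [left|].
  by exists t', s; split; [right|].
case=> t' [s [[<-|h1] [h2 h3]]]; last by right; exists t', s.
by left; rewrite h3; apply: (List.in_map (gcomm g t)).
Qed.

Lemma lcs_gensP i : (forall t, List.In t (lcs_gens i) -> L i t) /\
  (forall u, L i u -> gen g (fun y => List.In y (lcs_gens i) \/ L i.+1 y) u).
Proof.
elim: i => [|i [IH1 IH2]].
  split=> // u /genH hu K sK h; apply: hu => // a aF; apply: h; by left.
split=> [t /in_comms[t' [s [h1 [h2 ->]]]]|u hu].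
  by apply: lcs_comm; [apply: IH1 | apply: F0H].
have := lcs_comm_gen sH genH IH1 F0H IH2 hu.
move=> h K sK hK; apply: h => // a [h|h]; last by apply: hK; right.
by apply: hK; left; apply/in_comms.
Qed.

(** For [i = 0], powers of [t'] and [s] lie in [cycL] and so commute modulo [L 2]; bilinearity puts
    the power of [gcomm g t' s] with the product exponent into [L 2]. Later layers inherit torsion
    from the left argument. *)
Lemma lcs_gens_torsion i t : List.In t (lcs_gens i.+1) -> exists m, L i.+2 (t ^+ m.+1).
Proof.
elim: i t => [|i IH] t /in_comms[t' [s [h1 [h2 ->]]]].
  have [m hm] := torF0 h1; have [m' hm'] := torF0 h2.
  have Ht := F0H h1; have Hs := F0H h2.
  have hc := cycL_comm hm hm'.
  have h3 := gcomm_powl sH m.+1 (Ht : L 0 t') (subX sH m'.+1 Hs).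
  have h4 := gcomm_powr sH m'.+1 (Ht : L 0 t') Hs.
  have sL := lcs_subgroup sH 2.
  have h5 : L 2 (gcomm g t' (s ^+ m'.+1) ^+ m.+1).
    by apply: (subVr sL); apply: (subMr sL hc h3).
  have h6 : L 2 ((gcomm g t' s ^+ m'.+1) ^+ m.+1).
    apply: (pow_congr sH _ _ h4 h5).
      by apply: (subX (lcs_subgroup sH 1)); apply: lcs_comm.
    by apply: lcs_comm => //; apply: (subX sH).
  exists (m'.+1 * m.+1).-1; rewrite prednK // gpowM; exact: h6.
have [m hm] := IH _ h1.
have h0 := (lcs_gensP i.+1).1 _ h1; have Hs := F0H h2.
exists m; have h3 := gcomm_powl sH m.+1 h0 Hs.
apply: (subVr (lcs_subgroup sH i.+3)); apply: (subMr (lcs_subgroup sH i.+3) _ h3).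
exact: lcs_comm.
Qed.

Lemma lcs_fin_mod i : fin_mod (L i.+1) (L i.+2).
Proof.
have [h1 h2] := lcs_gensP i.+1.
have [|||L' hL] := @fin_mod_gen (L i.+1) (L i.+2) (lcs_gens i.+1)
  (lcs_subgroup sH i.+1) (lcs_subgroup sH i.+2).
- by move=> u; apply: lcs_S.
- by move=> u v hu hv; apply: lcs_comm => //; apply: lcs_H hv.
- by move=> t ht; split; [apply: h1 | apply: lcs_gens_torsion].
by exists L' => u /h2; apply: hL.
Qed.

(** In the chain [cyc g x], [cycL], [H], whole group, each step has finite index: the first because
    [L 1] consists of finitely many finite layers, the second because [H] modulo [cycL] is abelian
    with finitely many torsion generators. *)
Lemma nilpotent_virtually_cyclic : nilpotent g H -> finite_index g H -> virtually_cyclic g.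
Proof.
move=> [c hc] [n [LH [_ hLH]]].
have fL : fin_mod (L 1) (fun u => u = 1).
  have h i : fin_mod (L 1) (L i.+1).
    elim: i => [|i IH]; last exact: fin_mod_trans IH (lcs_fin_mod i).
    exists [:: 1] => u hu; exists 1; split; first by left.
    by rewrite !gE.
  have [L' hL] := h c; exists L' => u /hL[t [tL ht]]; exists t; split => //.
  by apply: hc; apply: lcs_S.
have fH : fin_mod H cycL.
  have [|||L' hL] := @fin_mod_gen H cycL F0 sH cycL_subgroup.
  - by move=> _ [z [c' [hz /lcs_H hc' ->]]]; apply: (subM sH); [apply: cyc_H | apply: hc'].
  - move=> u v hu hv; exists 1, (gcomm g u v); split; last by rewrite gE.
      exact: sub1 (cyc_subgroup x).
    exact: (@lcs_comm H 0).
  - by move=> t ht; split; [apply: F0H | apply: torF0].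
  exists L' => u /genH hu; apply: hL => K sK hK; apply: hu => // a aF.
  by apply: hK; left.
have fC : fin_mod cycL (cyc g x).
  have [L' hL] := fL; exists L' => _ [z [c' [hz hc' ->]]].
  have /hL[t [tL ht]] : L 1 (z * c' * z^-1) by apply: lcs_conjV => //; apply: cyc_H.
  exists t; split => //.
  by rewrite -(gmulVK (z * c') z) gmulA ht gE.
have fG : fin_mod (fun=> True) H by exists LH => u _; apply: hLH.
have [L' hL] := fin_mod_trans (fin_mod_trans fG fH) fC.
by exists x, (size L'), L'; split => // u; apply: hL.
Qed.
End VirtuallyCyclic.

(** Choose [x] of infinite order modulo [[H, H]], then [y] with no positive power in [cycL H x]; if
    either choice fails, [nilpotent_virtually_cyclic] applies. *)
Lemma independent_pair H (F0 : seq G) : is_subgroup g H -> nilpotent g H ->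
  finite_index g H -> ~ virtually_cyclic g ->
  (forall s, List.In s F0 -> H s) ->
  (forall h, H h -> gen g (fun u => List.In u F0) h) ->
  exists x y, [/\ List.In x F0, List.In y F0 &
    forall a b a' b' : nat, lcs g H 1 (x ^+ a * y ^+ b * (x ^+ a' * y ^+ b')^-1) ->
      a = a' /\ b = b'].
Proof.
move=> sH nH iH nvc F0H genH.
have sL := lcs_subgroup sH 1.
case: (pselect (exists x, List.In x F0 /\ forall m, ~ lcs g H 1 (x ^+ m.+1))); last first.
  move=> no; case: nvc.
  (* With the identity as cyclic generator, [cycL] is [[H, H]] itself. *)
  apply: (@nilpotent_virtually_cyclic H sH F0 1 F0H genH (sub1 sH) _ nH iH) => s sF.
  apply: contrapT => nm; apply: no; exists s; split => // m hm; apply: nm; exists m.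
  by exists 1, (s ^+ m.+1); split; [apply: sub1 (cyc_subgroup 1) | | rewrite gE].
case=> x [xF nx].
have Hx := F0H _ xF.
case: (pselect (exists y, List.In y F0 /\ forall m, ~ cycL H x (y ^+ m.+1))); last first.
  move=> no; case: nvc.
  apply: (@nilpotent_virtually_cyclic H sH F0 x F0H genH Hx _ nH iH) => s sF.
  by apply: contrapT => nm; apply: no; exists s; split => // m hm; apply: nm; exists m.
case=> y [yF ny]; exists x, y; split => //.
have Hy := F0H _ yF.
(* Cancelling would place a positive power of [y] in [cycL H x]. *)
have lt_false (a b a' b' : nat) : (b' < b)%N ->
    lcs g H 1 (x ^+ a * y ^+ b * (x ^+ a' * y ^+ b')^-1) -> False.
  move=> bb h; apply: (ny (b - b').-1); rewrite prednK ?subn_gt0 // gpowB; last exact: ltnW.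
  exists ((x ^+ a)^-1 * x ^+ a').
  exists ((x ^+ a')^-1 * (x ^+ a * y ^+ b * (x ^+ a' * y ^+ b')^-1) * x ^+ a'); split.
  - by apply: (subM (cyc_subgroup x)); [exists a; right | exists a'; left].
  - by apply: lcs_conj => //; apply: subX.
  - by rewrite !gE.
have lt_false' (a a' b : nat) : (a' < a)%N ->
    lcs g H 1 (x ^+ a * y ^+ b * (x ^+ a' * y ^+ b)^-1) -> False.
  move=> aa; rewrite !gE -gpowB ?(ltnW aa) // => h.
  by apply: (nx (a - a').-1); rewrite prednK ?subn_gt0.
have sym (a b a' b' : nat) : lcs g H 1 (x ^+ a * y ^+ b * (x ^+ a' * y ^+ b')^-1) ->
    lcs g H 1 (x ^+ a' * y ^+ b' * (x ^+ a * y ^+ b)^-1).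
  by move=> /(subV sL); rewrite !gE.
move=> a b a' b' h.
have eb : b = b'.
  case: (ltngtP b b') => // lt.
    by have [] := lt_false _ _ _ _ lt (sym _ _ _ _ h).
  by have [] := lt_false _ _ _ _ lt h.
split => //; rewrite -eb in h.
case: (ltngtP a a') => // lt.
  by have [] := lt_false' _ _ _ lt (sym _ _ _ _ h).
by have [] := lt_false' _ _ _ lt h.
Qed.

(** * Words in the generators and Schreier's lemma *)

Section Words.
Variable S : seq G.

Definition letter (s : G) : Prop := List.In s S \/ List.In s^-1 S.
Definition isword (w : seq G) : Prop := forall s, List.In s w -> letter s.
Definition wprod (w : seq G) : G := foldr (gmul g) 1 w.
Definition winv (w : seq G) : seq G := rev (map (ginv g) w).

Lemma letterV s : letter s -> letter s^-1.
Proof. by case=> h; [right; rewrite gE | left]. Qed.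

Lemma isword_cat w w' : isword w -> isword w' -> isword (w ++ w').
Proof. by move=> h h' s /List.in_app_iff[/h|/h']. Qed.

Lemma isword_catl w w' : isword (w ++ w') -> isword w.
Proof. by move=> h s sw; apply: h; apply/List.in_app_iff; left. Qed.

Lemma isword_catr w w' : isword (w ++ w') -> isword w'.
Proof. by move=> h s sw; apply: h; apply/List.in_app_iff; right. Qed.

Lemma isword_cons s w : letter s -> isword w -> isword (s :: w).
Proof. by move=> h h' t [<-|/h']. Qed.

Lemma isword_nil : isword [::].
Proof. by move=> s []. Qed.

Lemma wprod_cat w w' : wprod (w ++ w') = wprod w * wprod w'.
Proof. by elim: w => [|s w IH] /=; rewrite ?gE // IH gmulA. Qed.

Lemma wprod_inv w : wprod (winv w) = (wprod w)^-1.
Proof.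
elim: w => [|s w IH]; first by rewrite gE.
by rewrite /winv /= rev_cons -cats1 wprod_cat IH /= !gE.
Qed.

Lemma isword_inv w : isword w -> isword (winv w).
Proof.
elim: w => [|s w IH] h; first by move=> t [].
rewrite /winv /= rev_cons -cats1; apply: isword_cat.
  by apply: IH; apply: (@isword_catr [:: s]).
by apply: isword_cons => //; apply: letterV; apply: h; left.
Qed.

Lemma size_winv w : size (winv w) = size w.
Proof. by rewrite size_rev size_map. Qed.

Lemma generates_word u : generates g S -> exists2 w, isword w & wprod w = u.
Proof.
move=> /(_ u) hu; apply: (hu (fun u => exists2 w, isword w & wprod w = u)); last first.
  move=> s sS; exists [:: s]; last by rewrite /= gE.
  by apply: isword_cons => //; left.
split; first by exists [::].
split=> [_ _ [w hw <-] [w' hw' <-]|_ [w hw <-]].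
  by exists (w ++ w'); [apply: isword_cat | rewrite wprod_cat].
by exists (winv w); [apply: isword_inv | rewrite wprod_inv].
Qed.

Section Schreier.
Variables (H : G -> Prop) (n : nat).
Hypotheses (sH : is_subgroup g H) (iH : index_le g H n) (n_gt0 : (0 < n)%N).

(** Pigeonhole for [n.+1] elements and at most [n] right cosets of [H]. Since [index_le] counts left
    cosets, it is applied to the inverses. *)
Lemma prefix_collision (p : nat -> G) :
  exists i j, [/\ (i < j)%N, (j <= n)%N & H (p i * (p j)^-1)].
Proof.
have [L [sL hL]] := iH.
have hx (i : 'I_n.+1) : exists k : 'I_(size L), H ((nth 1 L k)^-1 * (p i)^-1).
  have [t [/(List.In_nth _ _ 1)[k [kL <-]] ht]] := hL (p i)^-1.
  have kL' : (k < size L)%N by apply/ssrnat.ltP.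
  exists (Ordinal kL') => /=.
  suff -> : nth 1 L k = List.nth k L 1 by [].
  by elim: (L) k {kL ht kL'} => [|? ? IH] [|k] //=.
have [F hF] := choice hx.
have /injectivePn[i [j ij eF]] : ~~ injectiveb F.
  apply/negP => /injectiveP /leq_card; rewrite !card_ord => h.
  by have := leq_trans h sL; rewrite ltnn.
have H2 k l : F k = F l -> H (p k * (p l)^-1).
  move=> e; have := hF l; rewrite -e => h.
  by have := subM sH (subV sH (hF k)) h; rewrite !gE.
case: (ltngtP i j) => [lt|lt|/val_inj e]; last by rewrite e eqxx in ij.
  by exists i, j; split => //; [rewrite -ltnS | apply: H2].
by exists j, i; split => //; [rewrite -ltnS | apply: H2].
Qed.

(** Two of the first [n.+1] prefixes of a long word lie in the same right coset of [H]; deleting the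
    letters between them keeps the coset of the word. *)
Lemma short_coset_word w : isword w ->
  exists w', [/\ isword w', (size w' < n)%N & H (wprod w * (wprod w')^-1)].
Proof.
move: {2}(size w) (leqnn (size w)) => k; elim: k w => [|k IH] w hk hw.
  exists w; split => //; last by rewrite gE; apply: sub1.
  by apply: leq_ltn_trans hk _.
have [lt|ge] := ltnP (size w) n; first by exists w; split => //; rewrite gE; apply: sub1.
have [i [j [ij jn hij]]] := prefix_collision (fun i => wprod (take i w)).
have [||w' [h1 h2 h3]] := IH (take i w ++ drop j w).
- by rewrite size_cat size_takel ?size_drop; lia.
- apply: isword_cat.
    by apply: (@isword_catl _ (drop i w)); rewrite cat_take_drop.
  by apply: (@isword_catr (take j w)); rewrite cat_take_drop.
exists w'; split => //.
have e : wprod w = wprod (take j w) * wprod (drop j w) by rewrite -wprod_cat cat_take_drop.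
by have := subM sH (subV sH hij) h3; rewrite e wprod_cat !gE.
Qed.

(** The word is read from left to right, each prefix being replaced by a short word of its coset. A
    replacement splits off [w1], one letter and the inverse of [w2], of total length at most
    [(n - 1) + 1 + (n - 1)]. *)
Lemma schreier_generators h : generates g S -> H h ->
  gen g (fun u => H u /\ exists2 w, isword w /\ (size w < n + n)%N & u = wprod w) h.
Proof.
move=> gS Hh; set J := gen g _.
have sJ : is_subgroup g J by apply: gen_subgroup.
have claim w : isword w ->
    exists w', [/\ isword w', (size w' < n)%N & J (wprod w * (wprod w')^-1)].
  elim/last_ind: w => [|w s IH] hw.
    by exists [::]; split => //=; rewrite !gE; apply: (sub1 sJ).
  rewrite -cats1 in hw *.
  have [w1 [h1 h2 h3]] := IH (isword_catl hw).
  have hs := isword_catr hw.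
  have [w2 [h4 h5 h6]] := short_coset_word (isword_cat h1 hs).
  exists w2; split => //.
  have : J (wprod (w1 ++ [:: s]) * (wprod w2)^-1).
    apply: gen_in; split => //; exists (w1 ++ [:: s] ++ winv w2).
      split; first by apply: isword_cat => //; apply: isword_cat => //; apply: isword_inv.
      by rewrite !size_cat size_winv /=; lia.
    by rewrite !wprod_cat wprod_inv gmulA.
  by move/(subM sJ h3); rewrite !wprod_cat !gE.
have [w hw eh] := generates_word h gS.
have [w' [h1 h2 h3]] := claim w hw; rewrite eh in h3.
have JH u : J u -> H u by apply => // a [].
have : J (wprod w').
  apply: gen_in; split; last by exists w' => //; split => //; lia.
  by have := subM sH (subV sH (JH _ h3)) Hh; rewrite !gE.
by move/(subM sJ h3); rewrite !gE.
Qed.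
End Schreier.

Definition letters : seq G := S ++ map (ginv g) S.

Lemma in_letters s : List.In s letters <-> letter s.
Proof.
rewrite List.in_app_iff /letter; split=> -[h|h]; [by left| |by left|].
  by right; have /List.in_map_iff[t [<- ht]] := h; rewrite gE.
by right; apply/List.in_map_iff; exists s^-1; rewrite gE.
Qed.

Fixpoint words (r : nat) : seq (seq G) :=
  if r is r'.+1 then
    [::] :: List.map (fun d => d.1 :: d.2) (List.list_prod letters (words r'))
  else [:: [::]].

Lemma in_words r w : List.In w (words r) <-> isword w /\ (size w <= r)%N.
Proof.
elim: r w => [|r IH] w /=.
  split; first by case=> // <-; split => //; apply: isword_nil.
  by case: w => [|s w] [_ hs] //; left.
split.
  case=> [<-|/List.in_map_iff[[s w'] [<- /List.in_prod_iff[hs /IH[hw hr]]]]].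
    by split => //; apply: isword_nil.
  by split => //; apply: isword_cons => //; apply/in_letters.
case: w => [|s w] [hw hr]; [by left | right].
apply/List.in_map_iff; exists (s, w); split => //; apply/List.in_prod_iff; split.
  by apply/in_letters; apply: hw; left.
by apply/IH; split => //; apply: (@isword_catr [:: s]).
Qed.

Lemma independent_words n H : (0 < n)%N -> generates g S -> ~ virtually_cyclic g ->
  is_subgroup g H -> nilpotent g H -> index_le g H n ->
  exists wx wy, [/\ isword wx /\ (size wx < n + n)%N, isword wy /\ (size wy < n + n)%N,
    H (wprod wx), H (wprod wy) &
    forall a b a' b' : nat,
      lcs g H 1 (wprod wx ^+ a * wprod wy ^+ b * (wprod wx ^+ a' * wprod wy ^+ b')^-1) ->
      a = a' /\ b = b'].
Proof.
move=> n0 gS nvc sH nH iH.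
(* This finite set generates [H] by Schreier's lemma, so the independent pair can be found among
   words of length less than [2n]. *)
pose F0 := List.filter (fun u => `[< H u >]) (List.map wprod (words (n + n).-1)).
have F0P u : List.In u F0 <-> H u /\ exists2 w, isword w /\ (size w < n + n)%N & u = wprod w.
  rewrite /F0 List.filter_In List.in_map_iff; split.
    case=> -[w [<- /in_words[hw hs]]] /asboolP Hu; split => //; exists w => //; split => //.
    by move: hs n0; clear; lia.
  case=> Hu [w [hw hs] eu]; split; last exact/asboolP.
  exists w; split => //; apply/in_words; split => //.
  by move: hs n0; clear; lia.
have [|||x [y [/F0P[Hx [wx [h1 h2] ex]] /F0P[Hy [wy [h3 h4] ey]] ind]]] :=
    @independent_pair H F0 sH nH _ nvc.
- by exists n.
- by move=> s /F0P[].
- move=> h Hh K sK hK; apply: (schreier_generators sH iH n0 gS Hh) => // u hu.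
  by apply: hK; apply/F0P.
by exists wx, wy; rewrite -ex -ey; split.
Qed.
End Words.

End GroupTheory.

(** * Product measures and the clutter theorem *)

Section ProductExpectation.
Variables (R : realFieldType) (p : R).
Hypotheses (p0 : 0 <= p) (p1 : p <= 1).

Let q0 : 0 <= 1 - p. Proof. by rewrite subr_ge0. Qed.

Definition upd (E : eqType) (f : E -> bool) (e : E) (b : bool) : E -> bool :=
  fun x => if x == e then b else f x.

(* The expectation of [F] when the coordinates in [l] are independent
   Bernoulli([p]) variables and the others are as in [f]. *)
Fixpoint bexp (E : eqType) (l : seq E) (F : (E -> bool) -> R) (f : E -> bool) : R :=
  if l is e :: l' then
    p * bexp l' F (upd f e true) + (1 - p) * bexp l' F (upd f e false)
  else F f.

Section Basic.
Variable E : eqType.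
Implicit Types (l : seq E) (F : (E -> bool) -> R) (f : E -> bool).

Lemma bexp_le_on l F F' f :
  (forall f', (forall x, x \notin l -> f' x = f x) -> F f' <= F' f') ->
  bexp l F f <= bexp l F' f.
Proof.
elim: l f => [|e l IH] f H /=; first by apply: H.
have aux b : bexp l F (upd f e b) <= bexp l F' (upd f e b).
  apply: IH => f' Hf'; apply: H => x; rewrite in_cons negb_or => /andP[xe xl].
  by rewrite Hf' // /upd (negbTE xe).
by apply: lerD; apply: ler_wpM2l.
Qed.

Lemma bexp_eq_on l F F' f :
  (forall f', (forall x, x \notin l -> f' x = f x) -> F f' = F' f') ->
  bexp l F f = bexp l F' f.
Proof.
by move=> H; apply/eqP; rewrite eq_le !bexp_le_on // => f' /H ->.
Qed.

Lemma bexp_le l F F' f : (forall f', F f' <= F' f') -> bexp l F f <= bexp l F' f.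
Proof. by move=> H; apply: bexp_le_on. Qed.

Lemma bexp_cst l c f : bexp l (fun=> c) f = c.
Proof. by elim: l f => //= e l IH f; rewrite !IH; ring. Qed.

Lemma bexpD l F F' f : bexp l (fun f => F f + F' f) f = bexp l F f + bexp l F' f.
Proof. by elim: l f => //= e l IH f; rewrite !IH; ring. Qed.

Lemma bexpZ l c F f : bexp l (fun f => c * F f) f = c * bexp l F f.
Proof. by elim: l f => //= e l IH f; rewrite !IH; ring. Qed.

Lemma bexp_sum (I : Type) (s : seq I) l (F : I -> (E -> bool) -> R) f :
  bexp l (fun f => \sum_(i <- s) F i f) f = \sum_(i <- s) bexp l (F i) f.
Proof.
elim: s f => [|i s IH] f.
  by rewrite big_nil -[RHS](bexp_cst l 0 f); congr bexp; apply/funext => ?; rewrite big_nil.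
rewrite big_cons -IH -bexpD; congr bexp; apply/funext => ?; by rewrite big_cons.
Qed.

Lemma bexp_cat l l' F f : bexp (l ++ l') F f = bexp l (bexp l' F) f.
Proof. by elim: l f => //= e l IH f; rewrite !IH. Qed.

Lemma bexp_open l e f : uniq l -> e \in l -> bexp l (fun f => (f e)%:R) f = p.
Proof.
elim: l f => //= e' l IH f /andP[el ul]; rewrite in_cons.
case: (eqVneq e e') => [ee _|ne /= el'].
  rewrite -ee in el *.
  have aux b : bexp l (fun f => (f e)%:R) (upd f e b) = b%:R.
    rewrite -[RHS](bexp_cst l _ (upd f e b)); apply: bexp_eq_on => f' Hf'.
    by rewrite Hf' // /upd eqxx.
  by rewrite !aux /=; ring.
by rewrite !IH //; ring.
Qed.

Lemma bexp_all_closed l D f : uniq l -> uniq D -> {subset D <= l} ->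
  bexp l (fun f => (all (predC f) D)%:R) f = (1 - p) ^+ size D.
Proof.
elim: l D f => [|e l IH] D f /=.
  by case: D => // e D _ _ /(_ e); rewrite mem_head => /(_ isT).
move=> /andP[el ul] uD sD; case: (boolP (e \in D)) => eD.
  have -> : bexp l (fun f => (all (predC f) D)%:R) (upd f e true) = 0.
    rewrite -(bexp_cst l 0 (upd f e true)); apply: bexp_eq_on => f' Hf'.
    case: allP => // /(_ e eD) /=; by rewrite Hf' // /upd eqxx.
  have -> : bexp l (fun f => (all (predC f) D)%:R) (upd f e false)
          = bexp l (fun f => (all (predC f) (rem e D))%:R) (upd f e false).
    apply: bexp_eq_on => f' Hf'; congr (_%:R); congr nat_of_bool.
    rewrite (perm_all _ (perm_to_rem eD)) /= Hf' // /upd eqxx /=; done.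
  rewrite IH ?rem_uniq // => [|x].
    rewrite size_rem // mulr0 add0r -exprS prednK //.
    by case: (D) eD.
  rewrite mem_rem_uniq // inE => /andP[xe /sD]; by rewrite in_cons (negbTE xe).
rewrite !IH //; first by ring.
  by move=> x xD; move: (sD _ xD); rewrite in_cons; case: eqP => // xe; rewrite -xe xD in eD.
by move=> x xD; move: (sD _ xD); rewrite in_cons; case: eqP => // xe; rewrite -xe xD in eD.
Qed.

End Basic.

(** * Replacing shared edge states by independent ones *)

Section Clutter.
Variables (E E' : eqType) (pi : E' -> E) (W : seq E' -> Prop) (L : seq E').
Hypothesis uL : uniq L.
Hypothesis W_inj : forall w, W w -> uniq (map pi w).
Hypothesis W_sub : forall w, W w -> {subset w <= L}.

Definition fset (e : E) (b : bool) (f : E' -> bool) : E' -> bool :=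
  fun x => if pi x == e then b else f x.

Definition fib (e : E) : seq E' := [seq x <- L | pi x == e].

Let Wopen (f : E' -> bool) : R := `[< exists w, W w /\ all f w >]%:R.

(** Independent states on the fibre of [e] give [F] at least the expectation that one shared state
    gives. *)
Let dom e F := forall f,
  p * F (fset e true f) + (1 - p) * F (fset e false f) <= bexp (fib e) F f.

Lemma mem_fib e x : (x \in fib e) = (pi x == e) && (x \in L).
Proof. by rewrite mem_filter. Qed.

(* No witness meets a fibre twice, so given the other edges the event is
   certain, impossible, or implied by a single edge of the fibre. *)
Lemma dom_Wopen e : dom e Wopen.
Proof.
move=> f.
have ge0 g : 0 <= Wopen g by rewrite /Wopen ler0n.
have le1 g : Wopen g <= 1 by rewrite /Wopen lern1 leq_b1.
case: (pselect (exists w, W w /\ all (fset e false f) w)) => [[w [Ww aw]]|n0].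
  apply: (@le_trans _ _ 1).
    have := ler_wpM2l p0 (le1 (fset e true f)).
    have := ler_wpM2l q0 (le1 (fset e false f)); lra.
  rewrite -(bexp_cst (fib e) 1 f); apply: bexp_le_on => f' Hf'.
  rewrite /Wopen; case: asboolP => // -[]; exists w; split => //.
  apply/allP => x xw; have := allP aw x xw; rewrite /fset; case: ifP => // pxe fx.
  by rewrite Hf' // mem_fib pxe.
have -> : Wopen (fset e false f) = 0 by rewrite /Wopen; case: asboolP.
rewrite mulr0 addr0.
case: (pselect (exists w, W w /\ all (fset e true f) w)) => [[w [Ww aw]]|n1]; last first.
  have -> : Wopen (fset e true f) = 0 by rewrite /Wopen; case: asboolP.
  by rewrite mulr0 -[leLHS](bexp_cst (fib e) 0 f); apply: bexp_le.
have -> : Wopen (fset e true f) = 1.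
  by rewrite /Wopen; case: asboolP => // -[]; exists w.
rewrite mulr1.
have [x xw pxe] : exists2 x, x \in w & pi x = e.
  apply: contrapT => nx; apply: n0; exists w; split => //.
  apply/allP => x xw; have := allP aw x xw; rewrite /fset; case: eqP => // pxe.
  by case: nx; exists x.
rewrite -[leLHS](@bexp_open _ (fib e) x f) ?filter_uniq //; last first.
  by rewrite mem_fib pxe eqxx /=; apply: W_sub xw.
apply: bexp_le_on => f' Hf'; case f'x : (f' x); last exact: ge0.
rewrite /Wopen; case: asboolP => // -[]; exists w; split => //.
apply/allP => y yw; case: (eqVneq y x) => [->|yx]; first by rewrite f'x.
have pye : pi y != e.
  apply: contra yx => /eqP pye; move: pye; rewrite -pxe => pyx.
  apply/eqP; have := W_inj Ww.
  move=> /(@uniqP _ e) ui.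
  have iy : (index y w < size w)%N by rewrite index_mem.
  have ix : (index x w < size w)%N by rewrite index_mem.
  have := ui (index y w) (index x w); rewrite !inE size_map => /(_ iy ix).
  rewrite !(nth_map x) // !nth_index // => /(_ pyx) eqi.
  by rewrite -(nth_index x yw) eqi nth_index.
rewrite Hf'; last by rewrite mem_fib (negbTE pye).
by have := allP aw y yw; rewrite /fset (negbTE pye).
Qed.

(* The analogue of [bexp] in which all edges above [e] share one state. *)
Fixpoint shexp (l : seq E) (F : (E' -> bool) -> R) (f : E' -> bool) : R :=
  if l is e :: l' then
    p * shexp l' F (fset e true f) + (1 - p) * shexp l' F (fset e false f)
  else F f.

Lemma fsetC e e' b b' f : e != e' -> fset e b (fset e' b' f) = fset e' b' (fset e b f).
Proof.
move=> ne; apply/funext => x; rewrite /fset.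
by case: eqP => // ->; rewrite (negbTE ne).
Qed.

Lemma bexp_fset e e' b F f : e != e' ->
  bexp (fib e) (F \o fset e' b) f = bexp (fib e) F (fset e' b f).
Proof.
move=> ne; have : {in fib e, forall x, pi x != e'}.
  by move=> x; rewrite mem_fib => /andP[/eqP -> _].
elim: (fib e) f => //= x l IH f H.
have H' : {in l, forall x, pi x != e'} by move=> y yl; apply: H; rewrite in_cons yl orbT.
rewrite !IH //.
have aux c : fset e' b (upd f x c) = upd (fset e' b f) x c.
  apply/funext => y; rewrite /fset /upd; case: (eqVneq y x) => // ->.
  by rewrite (negbTE (H x (mem_head _ _))).
by rewrite !aux.
Qed.

(** Fibres of distinct edges are disjoint, so fixing a shared state on one commutes with averaging
    over the other, and [dom e] passes to averages. *)
Lemma dom_shexp e l : e \notin l -> dom e (shexp l Wopen).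
Proof.
elim: l => [|e' l IH]; first by move=> _; apply: dom_Wopen.
rewrite in_cons negb_or => /andP[ne el] f /=.
rewrite bexpD !bexpZ.
have e1 := bexp_fset true (shexp l Wopen) f ne.
have e2 := bexp_fset false (shexp l Wopen) f ne.
rewrite /comp in e1 e2; rewrite e1 e2.
have h1 := ler_wpM2l p0 (IH el (fset e' true f)).
have h2 := ler_wpM2l q0 (IH el (fset e' false f)).
rewrite !(fsetC _ _ _ ne) in h1 h2.
rewrite -!(fsetC _ _ _ ne) in h1 h2 *.
lra.
Qed.

(** The fibres are made independent one at a time. *)
Lemma shexp_le_bexp l f : uniq l ->
  shexp l Wopen f <= bexp (flatten (map fib l)) Wopen f.
Proof.
elim: l f => //= e l IH f /andP[el ul].
rewrite bexp_cat; apply: le_trans (dom_shexp el f) _.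
by apply: bexp_le => f'; apply: IH.
Qed.

Lemma shexpE l F f : shexp l F (f \o pi) = bexp l (fun f => F (f \o pi)) f.
Proof.
elim: l f => //= e l IH f; rewrite -!IH.
by congr (_ * shexp _ _ _ + _ * shexp _ _ _).
Qed.

(* McDiarmid's clutter theorem. *)
Theorem clutter l f : uniq l ->
  bexp l (fun f => `[< exists w, W w /\ all (f \o pi) w >]%:R) f <=
  bexp (flatten (map fib l)) (fun f => `[< exists w, W w /\ all f w >]%:R) (f \o pi).
Proof. by move=> ul; rewrite -(shexpE l Wopen f); apply: shexp_le_bexp. Qed.

End Clutter.
End ProductExpectation.

(** * Multiscale percolation on a quadrant *)

Section Grid.
Local Open Scope nat_scope.
Variables (E : eqType) (Es : nat * nat -> seq E) (M K : nat).
Hypothesis M_gt0 : 0 < M.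
Hypothesis size_Es : forall v, size (Es v) <= M.
Hypothesis Es_overlap : forall e s, uniq s -> count (fun v => e \in Es v) s <= K.

Definition cells : seq (nat * nat) := [seq (i, j) | i <- iota 0 3, j <- iota 0 3].

Definition cell_pairs : seq ((nat * nat) * (nat * nat)) :=
  [seq c <- [seq (c1, c2) | c1 <- cells, c2 <- cells] | c.1 != c.2].

(** Boxes are named by their lower left corner. *)
Definition sub (k : nat) (a c : nat * nat) : nat * nat :=
  (a.1 + 3 ^ k * c.1, a.2 + 3 ^ k * c.2).

Fixpoint bad (f : E -> bool) (k : nat) (a : nat * nat) : bool :=
  if k is k'.+1 then
    has (fun c => bad f k' (sub k' a c.1) && bad f k' (sub k' a c.2)) cell_pairs
  else ~~ all f (Es a).

(* Each member consists of [2^k] edges, one from each of [2^k] distinct sites of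
   the box; if the box is bad, all edges of some member are closed. *)
Fixpoint confs (k : nat) (a : nat * nat) : seq (seq E) :=
  if k is k'.+1 then
    flatten [seq [seq x ++ y | x <- confs k' (sub k' a c.1), y <- confs k' (sub k' a c.2)]
            | c <- cell_pairs]
  else [seq [:: e] | e <- Es a].

Definition sites (k : nat) (a : nat * nat) : seq (nat * nat) :=
  [seq (x, y) | x <- iota a.1 (3 ^ k), y <- iota a.2 (3 ^ k)].

Lemma mem_sites k a v :
  (v \in sites k a) = [&& a.1 <= v.1, v.1 < a.1 + 3 ^ k, a.2 <= v.2 & v.2 < a.2 + 3 ^ k].
Proof.
case: v => x y; apply/allpairsP/and4P => /= [[[x' y'] /= []]|[h1 h2 h3 h4]].
  by rewrite !mem_iota => /andP[? ?] /andP[? ?] [-> ->].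
by exists (x, y); rewrite /= !mem_iota; split => //; apply/andP.
Qed.

Lemma sites_uniq k a : uniq (sites k a).
Proof.
by apply: allpairs_uniq; rewrite ?iota_uniq // => -[x y] [x' y'] _ _ /= [-> ->].
Qed.

Lemma mem_cells c : (c \in cells) = (c.1 < 3) && (c.2 < 3).
Proof. by case: c => [[|[|[|i]]] [|[|[|j]]]]. Qed.

Lemma mem_cell_pairs c :
  (c \in cell_pairs) = [&& c.1 != c.2, c.1 \in cells & c.2 \in cells].
Proof.
rewrite mem_filter; congr (_ && _); case: c => c1 c2.
by apply/allpairsP/andP => /= [[[c1' c2'] /= [h1 h2 [-> ->]]]|[h1 h2]] //; exists (c1, c2).
Qed.

Lemma bad_confs f k a : bad f k a -> has (all (predC f)) (confs k a).
Proof.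
elim: k a => [|k IH] a.
  rewrite /= -has_predC => /hasP[e eE fe].
  apply/hasP; exists [:: e]; last by rewrite /= andbT.
  by apply: map_f.
move=> /hasP[c cp /andP[b1 b2]].
have /hasP[x xc ax] := IH _ b1; have /hasP[y yc ay] := IH _ b2.
apply/hasP; exists (x ++ y); last by rewrite all_cat ax.
apply/flattenP; eexists; first by apply: (map_f _ cp).
by apply/allpairsP; exists (x, y).
Qed.

(** There are 72 ordered pairs of distinct subboxes, so the number of configurations is at most
    squared and multiplied by 81 from one scale to the next; the extra factor 81 turns this
    recursion into pure squaring. *)
Lemma size_confs k a : size (confs k a) * 81 <= (81 * M) ^ 2 ^ k.
Proof.
elim: k a => [|k IH] a; first by rewrite /= size_map expn1 mulnC leq_mul2l size_Es.
have -> : (81 * M) ^ 2 ^ k.+1 = (81 * M) ^ 2 ^ k * (81 * M) ^ 2 ^ k.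
  by rewrite -expnD addnn -mul2n -expnS.
set B := (81 * M) ^ 2 ^ k in IH *.
rewrite -[confs _ _]/(flatten [seq [seq x ++ y | x <- confs k (sub k a c.1),
  y <- confs k (sub k a c.2)] | c <- cell_pairs]) size_flatten /shape -map_comp sumnE big_map.
have H c : (size [seq x ++ y | x <- confs k (sub k a c.1), y <- confs k (sub k a c.2)])
    * (81 * 81) <= B * B.
  by rewrite size_allpairs; have := leq_mul (IH (sub k a c.1)) (IH (sub k a c.2)); rewrite mulnACA.
rewrite -(leq_pmul2r (isT : 0 < 81)) -mulnA big_distrl /=.
apply: (@leq_trans (\sum_(c <- cell_pairs) B * B)); first by apply: leq_sum => c _; apply: H.
by rewrite big_const_seq iter_addn_0 count_predT leq_mul2l orbT.
Qed.

Lemma conf_size k a c : c \in confs k a -> size c = 2 ^ k.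
Proof.
elim: k a c => [|k IH] a c; first by move=> /mapP[e _ ->].
move=> /flattenP[s /mapP[d _ ->]] /allpairsP[[x y] /= [/IH hx /IH hy ->]].
by rewrite size_cat hx hy addnn -mul2n expnS.
Qed.

(** The two halves of a configuration come from disjoint subboxes, so each occurrence of [e] is
    charged to a different site. *)
Lemma conf_count e k a c : c \in confs k a ->
  count_mem e c <= count (fun v => e \in Es v) (sites k a).
Proof.
elim: k a c => [|k IH] a c.
  move=> /mapP[e' e'E ->] /=; rewrite /sites /= !addn0.
  by case: eqP => // <-; rewrite -surjective_pairing e'E.
move=> /flattenP[s /mapP[d dp ->]] /allpairsP[[x y] /= [/IH hx /IH hy ->]].
rewrite count_cat; apply: leq_trans (leq_add hx hy) _.
rewrite -count_cat -!size_filter; apply: uniq_leq_size.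
  rewrite filter_uniq // cat_uniq !sites_uniq /= andbT.
  apply/hasPn => v; rewrite !mem_sites /=.
  move: dp; rewrite mem_cell_pairs !mem_cells.
  case: d hx hy => -[i j] [i' j'] _ _ /=; rewrite xpair_eqE.
  move: (3 ^ k) => m.
  by case: i => [|[|[|?]]] //; case: j => [|[|[|?]]] //;
    case: i' => [|[|[|?]]] //; case: j' => [|[|[|?]]] //=; lia.
move=> v; rewrite !mem_filter mem_cat => /andP[-> /=].
move: dp; rewrite mem_cell_pairs !mem_cells !mem_sites /= expnS.
case: d hx hy => -[i j] [i' j'] _ _ /= /and3P[_ /andP[h1 h2] /andP[h3 h4]].
by case/orP => /and4P[h5 h6 h7 h8]; apply/and4P; split; nia.
Qed.

(** Only distinct edges contribute to the probability of being closed; repetitions cost at most a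
    factor [K] in the exponent. *)
Lemma size_undup_count (c : seq E) : (forall e, count_mem e c <= K) ->
  size c <= K * size (undup c).
Proof.
move=> H; have -> : size c = \sum_(e <- undup c) count_mem e c.
  elim: c {H} => [|e c IH]; first by rewrite big_nil.
  rewrite [undup _]/=.
  have h0 (s : seq E) : uniq s -> \sum_(x <- s) (e == x) = (e \in s).
    elim: s => [|x s IHs] /=; first by rewrite big_nil.
    case/andP => xs us; rewrite big_cons IHs // in_cons.
    by case: (eqVneq e x) xs => [->|//] /negbTE ->.
  have h : \sum_(x <- (if e \in c then undup c else e :: undup c)) (e == x) = 1.
    rewrite h0; first by case: ifP => ec; rewrite ?mem_undup ?ec ?mem_head.
    by case: ifP => ec /=; rewrite ?undup_uniq // mem_undup ec.
  rewrite -[RHS]/(\sum_(x <- (if e \in c then undup c else e :: undup c))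
    ((e == x) + count_mem x c)) big_split h /= IH add1n; congr (_.+1).
  case: ifP => // ec; rewrite big_cons.
  have h2 : count_mem e c = 0 by apply/count_memPn; rewrite ec.
  by rewrite -[count _ c in RHS]/(count_mem e c) h2.
apply: (@leq_trans (\sum_(e <- undup c) K)); first by apply: leq_sum => e _.
by rewrite big_const_seq iter_addn_0 count_predT.
Qed.

(** * Connectivity of good boxes *)

Section Connectivity.
Variables (f : E -> bool) (C : nat * nat -> nat * nat -> Prop).
Hypothesis C_refl : forall v, C v v.
Hypothesis C_sym : forall v w, C v w -> C w v.
Hypothesis C_trans : forall u v w, C u v -> C v w -> C u w.
Hypothesis C_right : forall v, all f (Es v) -> C v (v.1.+1, v.2).
Hypothesis C_up : forall v, all f (Es v) -> C v (v.1, v.2.+1).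

(* [v] is a site of the box all of whose smaller enclosing boxes are good. *)
Fixpoint deep (k : nat) (a v : nat * nat) : Prop :=
  if k is k'.+1 then
    exists c, [/\ c \in cells, ~~ bad f k' (sub k' a c) & deep k' (sub k' a c) v]
  else v = a.

Lemma deep_ge k a v : deep k a v -> a.1 <= v.1.
Proof.
elim: k a => [|k IH] a; first by move=> ->.
by case=> c [_ _ /IH] /=; lia.
Qed.

Lemma good_unique k a c c' : ~~ bad f k.+1 a -> c \in cells -> c' \in cells -> c != c' ->
  bad f k (sub k a c) -> ~~ bad f k (sub k a c').
Proof.
move=> /hasPn H hc hc' ne b; have := H (c, c').
by rewrite mem_cell_pairs ne hc hc' => /(_ isT); rewrite negb_and => /orP[/negP[]|].
Qed.

Definition adj_cells (c c' : nat * nat) : bool :=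
  [|| c' == (c.1.+1, c.2), c' == (c.1, c.2.+1), c == (c'.1.+1, c'.2) | c == (c'.1, c'.2.+1)].

(** One round of breadth-first search among the good cells. *)
Definition grow (good : pred (nat * nat)) (s : seq (nat * nat)) : seq (nat * nat) :=
  [seq c <- cells | (c \in s) || good c && has (adj_cells c) s].

Lemma grow_sound (good : pred (nat * nat)) (r : nat * nat -> nat * nat -> Prop) c n d :
  r c c -> good c ->
  (forall d d', r c d -> good d -> d' \in cells -> good d' -> adj_cells d' d -> r c d') ->
  d \in iter n (grow good) [:: c] -> r c d /\ good d.
Proof.
move=> rc gc step; elim: n d => [|n IH] d; first by rewrite /= inE => /eqP ->.
rewrite iterS mem_filter => /andP[/orP[/IH //|/andP[gd /hasP[d' /IH[rd' gd'] ad]]] dc].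
by split => //; apply: step rd' gd' dc gd ad.
Qed.

Definition all_but (b : option (nat * nat)) : pred (nat * nat) := fun c => b != Some c.

(** A 3x3 square with at most one cell removed is connected. All cases are checked by computation;
    eight rounds suffice because there are nine cells. *)
Lemma grow_complete b c d : b \in None :: map Some cells ->
  c \in cells -> d \in cells -> all_but b c -> all_but b d ->
  exists m, d \in iter m (grow (all_but b)) [:: c].
Proof.
move=> bn cc dc gc gd.
have /allP /(_ b bn) /allP /(_ c cc) /allP /(_ d dc) T :
    all (fun b => all (fun c => all (fun d => all_but b c ==> (all_but b d ==>
      (d \in iter 8 (grow (all_but b)) [:: c]))) cells) cells) (None :: map Some cells).
  by vm_compute.
by exists 8; exact: (implyP (implyP T gc) gd).
Qed.

Definition box_adj k (a a' : nat * nat) : bool :=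
  (a' == (a.1 + 3 ^ k, a.2)) || (a' == (a.1, a.2 + 3 ^ k)).

Lemma box_adj_right k a c : box_adj k (sub k a c) (sub k a (c.1.+1, c.2)).
Proof. by apply/orP; left; rewrite /sub /= mulnS addnCA addnC. Qed.

Lemma box_adj_up k a c : box_adj k (sub k a c) (sub k a (c.1, c.2.+1)).
Proof. by apply/orP; right; rewrite /sub /= mulnS addnCA (addnC _ (3 ^ k)). Qed.

(** Only deep sites are compared, since sites inside a bad subbox may be cut off. *)
Definition linked k (a a' : nat * nat) : Prop :=
  forall v v', deep k a v -> deep k a' v' -> C v v'.

(** Existence, connection inside a box and connection between neighbours need each other in the
    induction. The good subboxes of a good box form a connected pattern, linked at the smaller
    scale; neighbouring good boxes are linked through two facing good subboxes. *)
Lemma good_box_connected k :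
  (forall a, ~~ bad f k a -> exists v, deep k a v) /\
  (forall a, ~~ bad f k a -> linked k a a) /\
  (forall a a', ~~ bad f k a -> ~~ bad f k a' -> box_adj k a a' -> linked k a a').
Proof.
elim: k => [|k [IH1 [IH2 IH3]]].
  split; first by move=> a _; exists a.
  split; first by move=> a _ v v' -> ->.
  move=> a a' /negPn ga _ h v v' -> ->.
  by case/orP: h => /eqP ->; rewrite addn1; [apply: C_right | apply: C_up].
have link_sym a a' : linked k a a' -> linked k a' a.
  by move=> h v v' dv dv'; apply: C_sym; apply: h.
have link_trans a a' a'' : ~~ bad f k a' -> linked k a a' -> linked k a' a'' -> linked k a a''.
  move=> /IH1[u du] h h' v v' dv dv'; apply: C_trans (h _ _ dv du) (h' _ _ du dv').
have H1 a : ~~ bad f k.+1 a -> exists v, deep k.+1 a v.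
  move=> ga; have [b0|g0] := boolP (bad f k (sub k a (0, 0))).
    have g1 := good_unique ga (isT : (0, 0) \in cells) (isT : (0, 1) \in cells) isT b0.
    by have [v dv] := IH1 _ g1; exists v, (0, 1).
  by have [v dv] := IH1 _ g0; exists v, (0, 0).
have H2 a : ~~ bad f k.+1 a -> linked k.+1 a a.
  move=> ga v v' [c [cc gc dv]] [c' [cc' gc' dv']].
  suff : linked k (sub k a c) (sub k a c') by apply.
  (* [b] records the bad subbox, if there is one. *)
  have [b [hb gb]] : exists b, b \in None :: map Some cells /\
      forall d, d \in cells -> all_but b d = ~~ bad f k (sub k a d).
    have [|/hasPn h] := boolP (has (fun d => bad f k (sub k a d)) cells).
      case/hasP => d dc bd; exists (Some d).
      split => [|d' dc']; first by rewrite inE (mem_map (@Some_inj _)).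
      rewrite /all_but (inj_eq (@Some_inj _)).
      case: (eqVneq d d') => [<-|ne]; first by rewrite bd.
      by rewrite (good_unique ga dc dc' ne bd).
    by exists None; split => // d /h ->.
  have := @grow_complete b c c' hb cc cc'; rewrite !gb // => /(_ gc gc') [m hm].
  have [||||[_ //]] := @grow_sound (all_but b)
    (fun c c' => c' \in cells /\ linked k (sub k a c) (sub k a c')) c m c'.
  - by split => //; apply: IH2.
  - by rewrite gb.
  - move=> d d' [dc ld] gd dc' gd' ad.
    split => //; rewrite gb // in gd; rewrite gb // in gd'.
    apply: link_trans ld _ => //.
    case/or4P: ad => /eqP e.
    + by apply: link_sym; apply: IH3 => //; rewrite e box_adj_right.
    + by apply: link_sym; apply: IH3 => //; rewrite e box_adj_up.
    + by apply: IH3 => //; rewrite e box_adj_right.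
    + by apply: IH3 => //; rewrite e box_adj_up.
  - exact: hm.
split => //; split => // a a' ga ga' adj.
suff [c [c' [cc cc' [gc gc' l]]]] : exists c c', [/\ c \in cells, c' \in cells &
    [/\ ~~ bad f k (sub k a c), ~~ bad f k (sub k a' c') & linked k (sub k a c) (sub k a' c')]].
  have [u du] := IH1 _ gc; have [u' du'] := IH1 _ gc'.
  move=> v v' dv dv'; apply: (@C_trans _ u).
    by apply: (H2 a) => //; exists c.
  apply: (@C_trans _ u'); first exact: l.
  by apply: (H2 a') => //; exists c'.
(* Three disjoint pairs of facing subboxes lie along the common side, and each of the two boxes
   spoils at most one pair. *)
have pick (F F' : nat -> nat * nat) :
    (forall i, i < 3 -> F i \in cells) -> (forall i, i < 3 -> F' i \in cells) ->
    injective F -> injective F' ->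
    exists2 i, i < 3 & ~~ bad f k (sub k a (F i)) /\ ~~ bad f k (sub k a' (F' i)).
  move=> hF hF' iF iF'.
  have one i j : i < 3 -> j < 3 -> i != j ->
      bad f k (sub k a (F i)) -> ~~ bad f k (sub k a (F j)).
    by move=> hi hj ne; apply: good_unique => //; rewrite ?hF // (inj_eq iF).
  have one' i j : i < 3 -> j < 3 -> i != j ->
      bad f k (sub k a' (F' i)) -> ~~ bad f k (sub k a' (F' j)).
    by move=> hi hj ne; apply: good_unique => //; rewrite ?hF' // (inj_eq iF').
  have [b0|g0] := boolP (bad f k (sub k a (F 0))).
    have [b1|g1] := boolP (bad f k (sub k a' (F' 1))).
      by exists 2 => //; split; [apply: (one 0) | apply: (one' 1)].
    by exists 1 => //; split => //; apply: (one 0).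
  have [b0|g0'] := boolP (bad f k (sub k a' (F' 0))); last by exists 0.
  have [b1|g1] := boolP (bad f k (sub k a (F 1))).
    by exists 2 => //; split; [apply: (one 1) | apply: (one' 0)].
  by exists 1 => //; split => //; apply: (one' 0).
case/orP: adj => /eqP ea.
  have [||||i i3 [gi gi']] := pick (fun i => (2, i)) (fun i => (0, i)).
  - by move=> i i3; rewrite mem_cells.
  - by move=> i i3; rewrite mem_cells.
  - by move=> i j [].
  - by move=> i j [].
  exists (2, i), (0, i); rewrite !mem_cells /= i3; split => //; split => //.
  apply: IH3 => //; apply/orP; left; rewrite ea /sub /= expnS; apply/eqP; congr (_, _); lia.
have [||||i i3 [gi gi']] := pick (fun i => (i, 2)) (fun i => (i, 0)).
- by move=> i i3; rewrite mem_cells /= i3.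
- by move=> i i3; rewrite mem_cells /= i3.
- by move=> i j [].
- by move=> i j [].
exists (i, 2), (i, 0); rewrite !mem_cells /= i3; split => //; split => //.
apply: IH3 => //; apply/orP; right; rewrite ea /sub /= expnS; apply/eqP; congr (_, _); lia.
Qed.

(** The good corner boxes make the origin deep at every scale, and one of the subboxes [(2, 0)] and
    [(2, 1)] is good; its deep sites have first coordinate at least [2 * 3 ^ k]. *)
Lemma far_connection k : (forall j, j <= k.+1 -> ~~ bad f j (0, 0)) ->
  exists v, k <= v.1 /\ C (0, 0) v.
Proof.
move=> good.
have o j : j <= k.+1 -> deep j (0, 0) (0, 0).
  elim: j => // j IH jk; exists (0, 0).
  have -> : sub j (0, 0) (0, 0) = (0, 0) by rewrite /sub /= muln0.
  by split => //; [apply: good; apply: ltnW | apply: IH; apply: ltnW].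
have [b [b2 gb]] : exists b, b \in [:: (2, 0); (2, 1)] /\ ~~ bad f k (sub k (0, 0) b).
  have [b0|g0] := boolP (bad f k (sub k (0, 0) (2, 0))); last by exists (2, 0).
  exists (2, 1); split => //.
  exact: good_unique (good k.+1 (leqnn _)) _ _ _ b0.
have [ne [conn _]] := good_box_connected k.
have [v dv] := ne _ gb.
have [_ [conn' _]] := good_box_connected k.+1.
exists v; split; last first.
  apply: (conn' (0, 0)) => //; [exact: good | exact: o | exists b; split => //].
  by move: b2; rewrite !inE => /orP[] /eqP ->.
have := deep_ge dv; have : b.1 = 2 by move: b2; rewrite !inE => /orP[] /eqP ->.
rewrite /sub /= => -> h; have := ltn_expl k (isT : 1 < 3); lia.
Qed.
End Connectivity.

Definition box_edges (k : nat) : seq E := undup (flatten [seq Es v | v <- sites k (0, 0)]).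

Lemma conf_box_edges j k c : j <= k -> c \in confs j (0, 0) -> {subset c <= box_edges k}.
Proof.
move=> jk cc e ec; have := conf_count e cc.
have : 0 < count_mem e c by rewrite -has_count has_pred1.
move=> h1 h2; have /hasP[v vs ev] : has (fun v => e \in Es v) (sites j (0, 0)).
  by rewrite has_count (leq_trans h1).
rewrite mem_undup; apply/flattenP; exists (Es v) => //; apply: map_f.
have := leq_pexp2l (isT : 0 < 3) jk.
by move: vs; rewrite !mem_sites /= => /andP[h3 h4] h; apply/andP; split; lia.
Qed.

(** * Probabilities of bad boxes and of far connections *)

Local Open Scope ring_scope.
Variables (R : realFieldType) (p r : R).
Hypotheses (p0 : 0 <= p) (p1 : p <= 1) (r0 : 0 <= r) (r1 : r <= 1).
Hypothesis pr : 1 - p <= r ^+ K.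
Hypothesis Mr : (81 * M)%:R * r <= 4%:R^-1.

(** Union bound over [confs]: there are at most [(81 * M) ^ 2 ^ j] configurations, and each has at
    least [2 ^ j / K] distinct edges, so by [pr] it is closed with probability at most
    [r ^+ (2 ^ j)]. *)
Lemma bad_prob j k f : (j <= k)%N ->
  bexp p (box_edges k) (fun f => (bad f j (0, 0)%N)%:R) f <= 4%:R^-1 ^+ (2 ^ j)%N.
Proof.
move=> jk.
have q0 : 0 <= 1 - p by rewrite subr_ge0.
apply: (@le_trans _ _ (\sum_(c <- confs j (0, 0)%N) r ^+ (2 ^ j)%N)); last first.
  rewrite big_const_seq iter_addr_0 count_predT -[X in X <= _]mulr_natl.
  have Mr0 : 0 <= (81 * M)%:R * r by rewrite mulr_ge0 ?ler0n.
  apply: (@le_trans _ _ (((81 * M)%:R * r) ^+ (2 ^ j)%N)); last first.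
    by apply: lerXn2r Mr; rewrite nnegrE // invr_ge0 ler0n.
  rewrite exprMn -natrX ler_wpM2r ?exprn_ge0 // ler_nat.
  by apply: leq_trans (size_confs j (0, 0)%N); rewrite leq_pmulr.
apply: (@le_trans _ _ (bexp p (box_edges k)
    (fun f => \sum_(c <- confs j (0, 0)%N) (all (predC f) c)%:R) f)).
  apply: bexp_le => // f'; case: (boolP (bad f' j (0, 0)%N)); last by rewrite sumr_ge0.
  move=> /bad_confs /hasP[c cc ac].
  rewrite (perm_big _ (perm_to_rem cc)) big_cons ac /= lerDl.
  by rewrite sumr_ge0.
rewrite bexp_sum big_seq [leRHS]big_seq; apply: ler_sum => c cc.
have -> : (fun f : E -> bool => (all (predC f) c)%:R) = (fun f => (all (predC f) (undup c))%:R : R).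
  by apply/funext => f'; congr (_%:R); congr nat_of_bool; apply: eq_all_r => x; rewrite mem_undup.
rewrite bexp_all_closed ?undup_uniq //; last first.
  by move=> x; rewrite mem_undup; apply: conf_box_edges cc x.
apply: (@le_trans _ _ ((r ^+ K) ^+ size (undup c))).
  by apply: lerXn2r pr; rewrite nnegrE ?exprn_ge0.
rewrite -exprM -(conf_size cc); apply: ler_wiXn2l => //.
apply: size_undup_count => e; apply: leq_trans (conf_count e cc) _.
exact/Es_overlap/sites_uniq.
Qed.

Theorem grid_percolation (C : (E -> bool) -> nat * nat -> nat * nat -> Prop) :
  (forall f v, C f v v) -> (forall f v w, C f v w -> C f w v) ->
  (forall f u v w, C f u v -> C f v w -> C f u w) ->
  (forall f v, all f (Es v) -> C f v (v.1.+1, v.2)) ->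
  (forall f v, all f (Es v) -> C f v (v.1, v.2.+1)) ->
  forall k f, 2%:R^-1 <= bexp p (box_edges k.+1)
    (fun f => `[< exists v, (k <= v.1)%N /\ C f (0, 0)%N v >]%:R) f.
Proof.
move=> Cr Cs Ct Cx Cy k f.
set B := fun f : E -> bool => \sum_(j <- iota 0 k.+2) ((bad f j (0, 0)%N)%:R : R).
set F := fun f : E -> bool => _.
have H : 1 <= bexp p (box_edges k.+1) (fun f => F f + B f) f.
  rewrite -[leLHS](bexp_cst p (box_edges k.+1) 1 f); apply: bexp_le => // f'.
  have B0 : 0 <= B f' by apply: sumr_ge0.
  rewrite /F; case: asboolP => [_|nC] /=; first by rewrite lerDl.
  rewrite add0r; have [|/hasPn g] := boolP (has (fun j => bad f' j (0, 0)%N) (iota 0 k.+2)).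
    case/hasP => j jk bj; rewrite /B (perm_big _ (perm_to_rem jk)) big_cons bj /= lerDl.
    by rewrite sumr_ge0.
  case: nC; apply: (far_connection (Cr f') (Cs f') (Ct f') (Cx f') (Cy f')).
  by move=> j jk; apply: g; rewrite mem_iota.
rewrite bexpD /B bexp_sum in H.
have S : \sum_(j <- iota 0 k.+2) bexp p (box_edges k.+1) (fun f => (bad f j (0, 0)%N)%:R) f
    <= 2%:R^-1.
  (* As [2 ^ j] is at least [j.+1], a geometric series with sum 1/3 remains. *)
  apply: (@le_trans _ _ (\sum_(j <- iota 0 k.+2) 4%:R^-1 ^+ j.+1)).
    rewrite big_seq [leRHS]big_seq; apply: ler_sum => j; rewrite mem_iota /= => jk.
    apply: le_trans (bad_prob f (jk : (j <= k.+1)%N)) _.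
    by apply: ler_wiXn2l; rewrite ?invr_ge0 ?ler0n ?invf_le1 ?ler1n ?ltr0n // ltn_expl.
  have -> : iota 0 k.+2 = index_iota 0 k.+2 by rewrite /index_iota subn0.
  (* The subtracted term lets the induction on [n] close. *)
  suff h n : \sum_(0 <= j < n) (4%:R^-1 : R) ^+ j.+1 <= 2%:R^-1 - 4%:R^-1 ^+ n * 3%:R^-1.
    by apply: le_trans (h _) _; rewrite lerBlDr lerDl mulr_ge0 ?exprn_ge0 // invr_ge0 ler0n.
  elim: n => [|n IH]; first by rewrite big_nil expr0; lra.
  rewrite big_nat_recr //= exprS; move: (4%:R^-1 ^+ n) IH => x; lra.
lra.
Qed.
End Grid.

(** * Finite-dimensional laws of the percolation process *)

Local Open Scope classical_set_scope.

(** By continuity from above the limsup of the events has probability at least [c], so the null set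
    [N] cannot contain it. *)
Lemma infinitely_often_off_null (R : realType) (d : measure_display) (T : measurableType d)
    (P : probability T R) (A : nat -> set T) (N : set T) (c : R) :
  (forall k, measurable (A k)) -> measurable N -> P N = 0%E -> 0 < c ->
  (forall k, (c%:E <= P (A k))%E) ->
  exists w, ~ N w /\ forall m, exists2 k, (m <= k)%N & A k w.
Proof.
move=> mA mN PN c0 PA; apply: contrapT => no.
pose B m := \bigcup_(k in [set k | (m <= k)%N]) A k.
have mB m : measurable (B m) by apply: bigcup_measurable => k _.
have PB m : (c%:E <= P (B m))%E.
  apply: le_trans (PA m) _; apply: le_measure; rewrite ?inE //.
  by move=> w Aw; exists m => //=.
have BN : \bigcap_m B m `<=` N.
  move=> w Bw; apply: contrapT => Nw; apply: no; exists w; split => // m.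
  by have [k mk Ak] := Bw m I; exists k.
have cv : P \o B @ \oo --> P (\bigcap_m B m).
  apply: nonincreasing_cvg_mu => //.
  - by apply: le_lt_trans (probability_le1 _ _) _ => //; rewrite ltry.
  - exact: bigcap_measurable.
  - move=> m m' mm'; apply/subsetPset => w [k mk Ak]; exists k => //=.
    exact: leq_trans mm' mk.
have : (c%:E <= P (\bigcap_m B m))%E.
  rewrite -(cvg_lim _ cv) //; apply: lime_ge; first by apply/cvg_ex; exists (P (\bigcap_m B m)).
  by apply: nearW => m; apply: PB.
have : (P (\bigcap_m B m) <= P N)%E.
  by apply: le_measure; rewrite ?inE //; apply: bigcap_measurable.
rewrite PN => h1 h2; have := le_trans h2 h1.
by rewrite lee_fin leNgt c0.
Qed.

Section JointLaw.
Variables (G : Type) (g : group_struct G) (S : seq G) (p : Rdefinitions.R).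
Variables (d : measure_display) (T : measurableType d) (P : probability T Rdefinitions.R).
Variable (X : G -> G -> T -> bool).
Hypothesis bX : bernoulli_bond_perc g S p P X.

(* An undirected edge is encoded as the set of its endpoints. *)
Definition is_edge (e : set G) : Prop := exists u v, cay_adj g S u v /\ e = [set u; v].

Definition state (w : T) (e : set G) : bool := `[< exists u v, e = [set u; v] /\ X u v w >].

Lemma pair_inj (V : Type) (u v u' v' : V) : [set u; v] = [set u'; v'] ->
  (u = u' /\ v = v') \/ (u = v' /\ v = u').
Proof.
move=> e.
have hu : [set u'; v'] u by rewrite -e; left.
have hv : [set u'; v'] v by rewrite -e; right.
have hu' : [set u; v] u' by rewrite e; left.
have hv' : [set u; v] v' by rewrite e; right.
by case: hu => hu; case: hv => hv; case: hu' => hu'; case: hv' => hv'; subst; auto.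
Qed.

Lemma state_edge w u v : state w [set u; v] = X u v w.
Proof.
apply/asboolP/idP => [[u' [v' [e xw]]]|xw]; last by exists u, v.
by have [[-> ->]|[-> ->]] := pair_inj e => //; rewrite (proj1 bX).
Qed.

Lemma measurable_state e b : is_edge e -> measurable [set w | state w e = b].
Proof.
move=> [u [v [_ ->]]]; have m := (proj1 (proj2 bX)) u v; case: b.
  rewrite (_ : [set w | _] = [set w : T | X u v w]) //.
  by apply/seteqP; split => w /=; rewrite state_edge.
rewrite (_ : [set w | _] = ~` [set w : T | X u v w]); first exact: measurableC.
by apply/seteqP; split => w /=; rewrite state_edge => /negP; rewrite ?negbK // => /negPf.
Qed.

Definition match_on (D : seq (set G)) (c : set G -> bool) : set T :=
  [set w | {in D, forall e, state w e = c e}].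

Lemma measurable_match D c : (forall e, e \in D -> is_edge e) -> measurable (match_on D c).
Proof.
elim: D => [|e D IH] hD.
  by rewrite (_ : match_on _ _ = setT) //; apply/seteqP; split => w.
rewrite (_ : match_on _ _ = [set w | state w e = c e] `&` match_on D c); last first.
  apply/seteqP; split => w /=.
    by move=> h; split=> [|e' e'D]; apply: h; rewrite ?mem_head // in_cons e'D orbT.
  by case=> h1 h2 e'; rewrite in_cons => /orP[/eqP ->|]; [|apply: h2].
apply: measurableI; first by apply: measurable_state; apply: hD; rewrite mem_head.
by apply: IH => e' e'D; apply: hD; rewrite in_cons e'D orbT.
Qed.

Lemma prob_match D c : uniq D -> (forall e, e \in D -> is_edge e) ->
  P (match_on D c) = (\prod_(e <- D) (if c e then p else 1 - p))%:E.
Proof.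
move=> uD hD.
pose o := (gone g, gone g).
(* Each edge gets an orientation, since [bernoulli_bond_perc] states the law for lists of ordered
   pairs. *)
have [es [eD adj]] : exists es : seq (G * G), D = [seq [set uv.1; uv.2] | uv <- es] /\
    forall i, (i < size es)%N -> cay_adj g S (nth o es i).1 (nth o es i).2.
  elim: D uD hD => [|e D IH] /=; first by exists [::].
  move=> /andP[_ uD] hD; have [|es [-> h]] := IH uD.
    by move=> e' e'D; apply: hD; rewrite in_cons e'D orbT.
  have [u [v [uv ->]]] := hD e (mem_head _ _).
  by exists ((u, v) :: es); split => // -[|i] //= /h.
have := proj2 (proj2 bX) es (map c D); rewrite size_map {1}eD size_map => /(_ erefl adj).
have nD i : (i < size es)%N -> nth set0 D i = [set (nth o es i).1; (nth o es i).2].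
  by move=> ie; rewrite eD (nth_map o).
have sD : size D = size es by rewrite eD size_map.
have dis i j : (i < size es)%N -> (j < size es)%N -> i <> j ->
    nth o es i <> nth o es j /\ nth o es i <> ((nth o es j).2, (nth o es j).1).
  move=> hi hj ij; have : nth set0 D i <> nth set0 D j.
    by move/eqP; rewrite nth_uniq ?sD // => /eqP.
  rewrite !nD // => ne; split => e; apply: ne; rewrite e //=.
  by apply/seteqP; split => z [->|->]; by [left|right].
move=> /(_ dis); rewrite big_map => <-; congr (P _).
apply/seteqP; split => w /= h.
  move=> i ie; have iD : (i < size D)%N by rewrite sD.
  rewrite (nth_map set0) // -(h _ (mem_nth set0 iD)).
  by rewrite nD // state_edge.
move=> e eD'; have := h (index e D); rewrite -sD index_mem eD' => /(_ isT).
rewrite (nth_map set0) ?index_mem // nth_index // => <-.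
have ie : (index e D < size es)%N by rewrite -sD index_mem.
by rewrite -{1}(nth_index set0 eD') nD // state_edge.
Qed.

Definition override (L : seq (set G)) (w : T) (c : set G -> bool) : set G -> bool :=
  fun e => if e \in L then state w e else c e.

Lemma override_cons e L w c : e \notin L ->
  override (e :: L) w c = override L w (upd c e (state w e)).
Proof.
move=> eL; apply/funext => x; rewrite /override /upd in_cons.
by case: eqP => [->|_] /=; rewrite ?(negbTE eL).
Qed.

(** [D] holds the edges whose states are already fixed. Moving the head of [L] into [D] with either
    state splits the event into two disjoint ones, as in the recursion of [bexp]. *)
Lemma joint_law_match (L D : seq (set G)) (F : (set G -> bool) -> bool) c :
  uniq (L ++ D) -> (forall e, e \in L ++ D -> is_edge e) ->
  measurable [set w | match_on D c w /\ F (override L w c)] /\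
  P [set w | match_on D c w /\ F (override L w c)] =
    ((\prod_(e <- D) (if c e then p else 1 - p)) * bexp p L (fun f => (F f)%:R) c)%:E.
Proof.
elim: L D c => [|e L IH] D c; rewrite ?cat0s ?cat_cons.
  move=> uD hD.
  case Fc : (F c).
    rewrite (_ : [set w | _] = match_on D c); last first.
      by apply/seteqP; split => w //= -[].
    by rewrite /= ?Fc mulr1 prob_match //; split => //; apply: measurable_match.
  rewrite (_ : [set w | _] = set0); last first.
    by apply/seteqP; split => w //= -[].
  by rewrite /= ?Fc mulr0 measure0; split.
move=> /andP[eLD uLD] hLD.
have [eL eD] : e \notin L /\ e \notin D by move: eLD; rewrite mem_cat negb_or => /andP.
have perm : perm_eq (L ++ e :: D) (e :: L ++ D) by rewrite -cat1s perm_catCA.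
have uD' : uniq (L ++ e :: D) by rewrite (perm_uniq perm) /= eLD.
have hD' e' : e' \in L ++ e :: D -> is_edge e' by rewrite (perm_mem perm); apply: hLD.
have IHb b := IH (e :: D) (upd c e b) uD' hD'.
pose A b := [set w | match_on (e :: D) (upd c e b) w /\ F (override L w (upd c e b))].
have mm b w : match_on (e :: D) (upd c e b) w <-> state w e = b /\ match_on D c w.
  split=> [h|[h1 h2] e'].
    split=> [|e' e'D]; first by rewrite h ?mem_head // /upd eqxx.
    rewrite h ?in_cons ?e'D ?orbT // /upd; case: eqP e'D eD => // -> ->.
    by [].
  rewrite in_cons /upd; case: eqP => [-> _|_ /=]; [exact: h1 | exact: h2].
rewrite (_ : [set w | _] = A true `|` A false); last first.
  apply/seteqP; split => w /=.
    rewrite override_cons // => -[h1 h2]; case se: (state w e) h2 => h2.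
      by left; split => //; apply/mm.
    by right; split => //; apply/mm.
  rewrite override_cons //.
  by case=> -[/mm[-> h1] h2].
have dj : A true `&` A false = set0.
  apply/seteqP; split => w //= -[[/mm[h1 _] _] [/mm[h2 _] _]].
  by rewrite h1 in h2.
have [m1 p1] := IHb true; have [m2 p2] := IHb false.
split; first exact: measurableU.
have -> : P (A true `|` A false) = (P (A true) + P (A false))%E by apply: measureU.
rewrite {1}/A p1 {1}/A p2 -EFinD !big_cons.
have pc b : \prod_(e' <- D) (if upd c e b e' then p else 1 - p) =
    \prod_(e' <- D) (if c e' then p else 1 - p).
  rewrite big_seq [RHS]big_seq; apply: eq_bigr => e' e'D.
  by rewrite /upd; case: eqP e'D eD => // -> ->.
rewrite !pc /upd !eqxx; congr (_%:E).
by rewrite /=; ring.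
Qed.

Lemma joint_law (L : seq (set G)) (F : (set G -> bool) -> bool) c :
  uniq L -> (forall e, e \in L -> is_edge e) ->
  measurable [set w | F (override L w c)] /\
  P [set w | F (override L w c)] = (bexp p L (fun f => (F f)%:R) c)%:E.
Proof.
move=> uL hL; have := @joint_law_match L [::] F c; rewrite cats0 => /(_ uL hL).
rewrite big_nil mul1r.
rewrite (_ : [set w | match_on [::] c w /\ _] = [set w | F (override L w c)]) //.
by apply/seteqP; split => w /=; [case|].
Qed.

End JointLaw.

(** * Lifting from the Schreier graph *)

Section Reach.
Variables (V : Type) (E : V -> V -> Prop).

Lemma reach_trans x y z : reach E x y -> reach E y z -> reach E x z.
Proof. by move=> h; elim=> // u v _ IH Euv; apply: reach_step IH Euv. Qed.

Lemma reach_sym x y : (forall u v, E u v -> E v u) -> reach E x y -> reach E y x.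
Proof.
move=> sE; elim=> [|u v _ IH Euv]; first exact: reach_refl.
by apply: reach_trans IH; apply: reach_step (reach_refl _ _) (sE _ _ Euv).
Qed.
End Reach.

Lemma reach_path (V : eqType) (E : V -> V -> Prop) x y : reach E x y ->
  exists p, path (fun a b => `[< E a b >]) x p /\ last x p = y.
Proof.
elim=> [|u v _ [p [hp <-]] Euv]; first by exists [::].
by exists (rcons p v); rewrite rcons_path last_rcons hp; split => //; apply/asboolP.
Qed.

Lemma mem_map_In (A : Type) (B : eqType) (F : A -> B) (l : seq A) (b : B) :
  (b \in map F l) <-> exists2 a, List.In a l & b = F a.
Proof.
elim: l => [|a l [IH1 IH2]]; first by split => // -[].
rewrite map_cons in_cons; split.
  case/orP => [/eqP ->|/IH1[a' h1 h2]]; first by exists a => //; left.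
  by exists a' => //; right.
case=> a' [<- ->|h e]; first by rewrite eqxx.
by apply/orP; right; apply: IH2; exists a'.
Qed.

Fixpoint pedges (V : Type) (A : V) (p : seq V) : seq (set V) :=
  if p is B :: p' then [set A; B] :: pedges B p' else [::].

Lemma pedges_sub (V : eqType) (A : V) p e B : e \in pedges A p -> e B -> B \in A :: p.
Proof.
elim: p A => //= C p IH A; rewrite in_cons => /orP[/eqP ->|ep eB].
  by case=> ->; rewrite !in_cons eqxx ?orbT.
by rewrite in_cons; apply/orP; right; apply: IH.
Qed.

Lemma pedges_uniq (V : eqType) (A : V) p : uniq (A :: p) -> uniq (pedges A p).
Proof.
elim: p A => //= C p IH A /andP[Ap uCp]; rewrite IH // andbT.
by apply: contra Ap => h; apply: pedges_sub h _; left.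
Qed.

Section SchreierGraph.
Variables (G : Type) (g : group_struct G) (S : seq G) (K : G -> Prop).
Hypothesis sK : is_subgroup g K.
Local Notation "x * y" := (gmul g x y) : grp_scope.
Local Notation "x ^-1" := (ginv g x) : grp_scope.
Local Notation "1" := (gone g) : grp_scope.
Local Notation "x ^+ k" := (gpow g x k) : grp_scope.
Local Notation letter := (letter g S).
Local Notation isword := (isword g S).
Local Notation wprod := (wprod g).
Local Open Scope grp_scope.

(** Right cosets of [K] are the vertices of the Schreier graph; right multiplication acts on
    them. *)
Definition coset (u : G) : set G := [set v | K (v * u^-1)].

Lemma cosetP u v : coset u = coset v <-> K (u * v^-1).
Proof.
split=> [e|h].
  by have : coset u u; [rewrite /coset /= gE; apply: sub1|rewrite e].
apply/seteqP; split=> z /= hz; rewrite /coset /= in hz *.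
  by have := subM sK hz h; rewrite !gE.
by have := subM sK hz (subV sK h); rewrite !gE.
Qed.

Lemma coset_mulr u v s : coset (u * s) = coset (v * s) <-> coset u = coset v.
Proof. by rewrite !cosetP !gE. Qed.

Definition eproj (e : set G) : set (set G) := coset @` e.

Lemma eproj_pair u v : eproj [set u; v] = [set coset u; coset v].
Proof.
apply/seteqP; split=> [_ [z [->|->] <-]|_ [->|->]]; [by left|by right| |].
  by exists u => //; left.
by exists v => //; right.
Qed.

(** The edges of the walk in the Cayley graph that starts at [u] and reads [t]. *)
Definition gpath (u : G) (t : seq G) : seq (set G) :=
  [seq [set u * wprod (take i t); u * wprod (take i.+1 t)] | i <- iota 0 (size t)].

Lemma gpath_cons u s t : gpath u (s :: t) = [set u; u * s] :: gpath (u * s) t.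
Proof.
rewrite /gpath /= take0 /= !gE; congr (_ :: _).
rewrite (iotaDl 1 0) -map_comp; apply: eq_map => i /=.
by rewrite !gmulA.
Qed.

Definition step (f : set (set G) -> bool) (A B : set G) : Prop :=
  (exists u s, [/\ letter s, A = coset u & B = coset (u * s)]) /\ f [set A; B].

Lemma step_sym f A B : step f A B -> step f B A.
Proof.
move=> [[u [s [ls eA eB]]] fAB]; split; last by rewrite setUC.
by exists (u * s), s^-1; split; [apply: letterV | | rewrite !gE].
Qed.

Lemma gpath_reach f u t : isword t -> all f (map eproj (gpath u t)) ->
  reach (step f) (coset u) (coset (u * wprod t)).
Proof.
elim: t u => [|s t IH] u ht; first by rewrite /= !gE => _; apply: reach_refl.
rewrite gpath_cons /= eproj_pair => /andP[h1 h2].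
have := IH (u * s) (@isword_catr _ _ _ [:: s] _ ht) h2; rewrite -gmulA.
apply: reach_trans; apply: reach_step (reach_refl _ _) _; split => //.
by exists u, s; split => //; apply: ht; left.
Qed.

(** A step witnessed at the representative [v] is lifted at the current endpoint [u] by the same
    letter, because right multiplication acts on cosets. *)
Lemma lift_path f u p : path (fun A B => `[< step f A B >]) (coset u) p ->
  uniq (coset u :: p) ->
  exists t, [/\ isword t, (forall s, List.In s t -> s <> 1),
    map eproj (gpath u t) = pedges (coset u) p, all f (pedges (coset u) p) &
    last (coset u) p = coset (u * wprod t)].
Proof.
elim: p u => [|B p IH] u /=.
  by move=> _ _; exists [::]; split => //; rewrite /= !gE.
move=> /andP[/asboolP[[v [s [ls eA eB]]] fAB] hp] /andP[nA uB].
have eB' : B = coset (u * s) by rewrite eB; apply/coset_mulr.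
rewrite eB' in hp uB.
have [t [h1 h2 h3 h4 h5]] := IH _ hp uB.
exists (s :: t); split.
- exact: isword_cons.
- move=> s' [<-|]; last exact: h2.
  (* A trivial letter would repeat a vertex of the self-avoiding path. *)
  by move=> s1; move: nA; rewrite eB' s1 gE mem_head.
- by rewrite gpath_cons /= h3 eproj_pair -eB'.
- by rewrite fAB eB'.
- by rewrite eB' h5 /= gmulA.
Qed.

Lemma gpath_open (d : measure_display) (T : measurableType d) (X : G -> G -> T -> bool) w u t :
  isword t -> (forall s, List.In s t -> s <> 1) ->
  (forall a b, state X w [set a; b] = X a b w) ->
  all (state X w) (gpath u t) -> reach (open_edge g S X w) u (u * wprod t).
Proof.
move=> + + hst; elim: t u => [|s t IH] u ht t1; first by rewrite /= gE => _; apply: reach_refl.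
rewrite gpath_cons => /andP[h1 h2].
have ht' : isword t := @isword_catr _ _ _ [:: s] _ ht.
have := IH (u * s) ht' _ h2; rewrite -gmulA => /(_ (fun s' h => t1 s' (or_intror h))).
apply: reach_trans; apply: reach_step (reach_refl _ _) _; split; last by rewrite -hst.
have ls : letter s by apply: ht; left.
(* [cay_adj] writes the first endpoint as the second times a letter, hence the inverse. *)
exists s^-1; split; first exact: letterV ls.
split; last by rewrite gE.
by move=> e; apply: (t1 s); [left | rewrite -(ginvK g s) e ginv1].
Qed.

Lemma gpath_size u t : size (gpath u t) = size t.
Proof. by rewrite size_map size_iota. Qed.

Lemma gpath_ball t r e : isword t -> (forall s, List.In s t -> s <> 1) -> (size t <= r)%N ->
  e \in gpath 1 t -> exists w s, [/\ List.In w (words g S r), letter s, s <> 1 &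
    e = [set wprod w; wprod w * s]].
Proof.
move=> ht t1 tr /mapP[i]; rewrite mem_iota /= add0n => it ->.
have e2 := cat_take_drop i t; move: e2; rewrite (drop_nth 1 it) => e2.
have si : List.In (nth 1 t i) t.
  by rewrite -[X in List.In _ X]e2; apply/List.in_app_iff; right; left.
exists (take i t), (nth 1 t i); split; [|exact: ht|exact: t1|].
  apply/in_words; split; first by apply: (@isword_catl _ _ _ _ (drop i t)); rewrite cat_take_drop.
  by rewrite size_takel; [apply: leq_trans (ltnW it) tr | apply: ltnW].
by rewrite (take_nth 1 it) -cats1 wprod_cat /= !gE.
Qed.

Lemma ball_edges r : exists L : seq (set G), [/\ uniq L, forall e, e \in L -> is_edge g S e &
  forall w s, List.In w (words g S r) -> letter s -> s <> 1 ->
    [set wprod w; wprod w * s] \in L].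
Proof.
pose prs := List.filter (fun d => `[< letter d.2 /\ d.2 <> 1 >])
  (List.list_prod (List.map wprod (words g S r)) (letters g S)).
exists (undup (map (fun d => [set d.1; d.1 * d.2]) prs)); split; first exact: undup_uniq.
  move=> e; rewrite mem_undup => /mem_map_In[[u s]] /List.filter_In[_ /asboolP[/= ls s1]] ->.
  exists (u * s), u; split; last by rewrite setUC.
  by exists s.
move=> w s hw ls s1; rewrite mem_undup; apply/mem_map_In; exists (wprod w, s) => //.
apply/List.filter_In; split; last exact/asboolP.
apply/List.in_prod; first by apply: List.in_map.
exact/in_letters.
Qed.

(** Equality of the edges forces [phi v] to be one of two fixed vertices, and [phi] is injective. *)
Lemma count_edge_le2 (phi psi : nat * nat -> set G) e s : injective phi -> uniq s ->
  (count (fun v => e == [set phi v; psi v]) s <= 2)%N.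
Proof.
move=> iphi us; have [|/hasPn h] := boolP (has (fun v => e == [set phi v; psi v]) s); last first.
  by rewrite (eq_in_count (a2 := pred0)) ?count_pred0 // => v /h /negbTE.
case/hasP => v0 _ /eqP e0.
have le1 A : (count (fun v => phi v == A) s <= 1)%N.
  have := count_uniq_mem A (_ : uniq (map phi s)); rewrite map_inj_uniq // => /(_ us).
  by rewrite count_map => ->; case: (_ \in _).
apply: leq_trans (leq_add (le1 (phi v0)) (le1 (psi v0))).
rewrite -count_predUI; apply: leq_trans (leq_addr _ _).
apply: sub_count => v /eqP h; rewrite e0 in h.
by case: (pair_inj h) => -[e1 e2]; apply/orP; [left | right]; apply/eqP.
Qed.

End SchreierGraph.

Lemma count_has_le (I V : Type) (Q : I -> pred V) (l : seq I) (s : seq V) m :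
  (forall i, (count (Q i) s <= m)%N) ->
  (count (fun v => has (Q^~ v) l) s <= m * size l)%N.
Proof.
move=> h; elim: l => [|i l IH] /=; first by rewrite (eq_count (a2 := pred0)) ?count_pred0.
rewrite mulnS; apply: leq_trans (leq_add (h i) IH).
by rewrite -count_predUI leq_addr.
Qed.

(** * The quadrant of the square grid in the Schreier graph *)

Section GridInSchreierGraph.
Variables (G : Type) (g : group_struct G) (S : seq G) (H : G -> Prop) (n : nat).
Hypothesis sH : is_subgroup g H.
Variables wx wy : seq G.
Hypotheses (wxS : isword g S wx) (wyS : isword g S wy).
Hypotheses (wxn : (size wx < n + n)%N) (wyn : (size wy < n + n)%N).
Local Notation "x * y" := (gmul g x y) : grp_scope.
Local Notation "x ^-1" := (ginv g x) : grp_scope.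
Local Notation "1" := (gone g) : grp_scope.
Local Notation "x ^+ k" := (gpow g x k) : grp_scope.
Local Notation x := (wprod g wx).
Local Notation y := (wprod g wy).
Local Notation K := (lcs g H 1).
Local Notation coset := (coset g K).
Local Notation eproj := (eproj g K).
Local Notation gpath := (gpath g).
Hypotheses (Hx : H x) (Hy : H y).
Hypothesis ind : forall a b a' b' : nat,
  K (x ^+ a * y ^+ b * (x ^+ a' * y ^+ b')^-1)%grp -> a = a' /\ b = b'.
Let sK : is_subgroup g K := lcs_subgroup sH 1.

Definition pt (v : nat * nat) : G := (x ^+ v.1 * y ^+ v.2)%grp.

Definition Es (v : nat * nat) : seq (set (set G)) :=
  map eproj (gpath (pt v) wx) ++ map eproj (gpath (pt v) wy).

Lemma pt_inj t : injective (fun v => coset (pt v * t)%grp).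
Proof.
move=> [a b] [a' b'] /(coset_mulr sK) /(cosetP sK) /ind /= [-> ->]; by [].
Qed.

Lemma size_Es v : (size (Es v) <= 4 * n)%N.
Proof. by rewrite size_cat !size_map !size_iota; lia. Qed.

(** At a fixed letter position of [wx] or [wy], the starting coset determines the grid point by
    [pt_inj], so an edge is used there at most twice; there are fewer than [4 * n] positions. *)
Lemma Es_overlap e s : uniq s -> (count (fun v => e \in Es v) s <= 8 * n)%N.
Proof.
move=> us.
have h w : (count (fun v => e \in map eproj (gpath (pt v) w)) s <= 2 * size w)%N.
  have := @count_has_le nat _ (fun i v => e == [set coset (pt v * wprod g (take i w))%grp;
    coset (pt v * wprod g (take i.+1 w))%grp]) (iota 0 (size w)) s 2 _.
  rewrite size_iota => h; apply: leq_trans (h _).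
    apply: sub_count => v; rewrite -map_comp => /mapP[i ii ->]; apply/hasP; exists i => //.
    by rewrite /= eproj_pair.
  by move=> i; apply: count_edge_le2 => //; apply: pt_inj.
have := leq_add (h wx) (h wy); rewrite -count_predUI => h'.
apply: (@leq_trans (2 * size wx + 2 * size wy)); last by lia.
apply: leq_trans h'; apply: leq_trans (leq_addr _ _).
by apply: sub_count => v; rewrite mem_cat.
Qed.

(** Reading [wx] at [x ^+ a * y ^+ b] ends at [x ^+ a * y ^+ b * x], which differs from
    [x ^+ a.+1 * y ^+ b] on the left by a conjugate of a commutator, an element of [K]. *)
Lemma reach_right f v : all f (Es v) ->
  reach (step g S K f) (coset (pt v)) (coset (pt (v.1.+1, v.2))).
Proof.
rewrite all_cat => /andP[h _]; have := gpath_reach wxS h.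
suff -> : coset (pt v * x)%grp = coset (pt (v.1.+1, v.2)) by [].
apply/(cosetP sK); rewrite /pt /=.
have hc : K (gcomm g (y ^+ v.2)^-1 x^-1)%grp.
  apply: (@lcs_comm _ _ H 0); last exact: (subV sH).
  by apply: (subV sH); apply: subX.
have := lcs_conjV sH hc (subX sH v.1 Hx).
rewrite -[(x * x ^+ v.1)%grp]/(x ^+ v.1.+1)%grp gpowSr.
by rewrite /gcomm !gE.
Qed.

Lemma reach_up f v : all f (Es v) ->
  reach (step g S K f) (coset (pt v)) (coset (pt (v.1, v.2.+1))).
Proof.
rewrite all_cat => /andP[_ h]; have := gpath_reach wyS h.
suff -> : (pt v * y)%grp = pt (v.1, v.2.+1) by [].
by rewrite /pt -[(v.1, v.2.+1).2]/(v.2.+1) gpowSr gmulA.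
Qed.

Variables (p r : Rdefinitions.R).
Hypotheses (n_gt0 : (0 < n)%N) (p0 : 0 <= p) (p1 : p <= 1) (r0 : 0 <= r) (r1 : r <= 1).
Hypothesis pr : 1 - p <= r ^+ (8 * n).
Hypothesis nr : (81 * (4 * n))%:R * r <= 4%:R^-1.

Variables (d : measure_display) (T : measurableType d) (P : probability T Rdefinitions.R).
Variable X : G -> G -> T -> bool.
Hypothesis bX : bernoulli_bond_perc g S p P X.

(** [grid_percolation] gives a far connection in the Schreier graph, [clutter] transfers its
    probability to lifts of self-avoiding paths, and [joint_law] to the process on [T]. *)
Lemma far_event k : exists A : set T, [/\ measurable A, ((2%:R^-1)%:E <= P A)%E &
  forall w, A w -> exists u v,
    [/\ reach (open_edge g S X w) (gone g) u, (k <= v.1)%N & coset u = coset (pt v)]].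
Proof.
set l := box_edges Es k.+1.
have ul : uniq l by apply: undup_uniq.
(* Witnesses are walks from the identity whose projections use distinct edges of the box and end at
   a far grid point. *)
pose W (e : seq (set G)) := exists t, [/\ isword g S t /\ (forall s, List.In s t -> s <> gone g),
  e = gpath (gone g) t, uniq (map eproj e), {subset map eproj e <= l} &
  exists2 v, (k <= v.1)%N & coset (wprod g t) = coset (pt v)].
(* The projected edges of a witness are distinct members of [l], so it has at most [size l] edges
   and stays in a finite ball. *)
have [L [uL LE Lin]] := ball_edges g S (size l).
have W_sub e : W e -> {subset e <= L}.
  move=> [t [[ht t1] -> ut st _]] z zt.
  have tl : (size t <= size l)%N.
    by have := uniq_leq_size ut st; rewrite size_map gpath_size.
  have [w [s [h1 h2 h3 ->]]] := gpath_ball ht t1 tl zt.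
  exact: Lin.
have W_inj e : W e -> uniq (map eproj e) by case=> t [].
pose L' := flatten (map (fib eproj L) l).
have memL' z : (z \in L') = (z \in L) && (eproj z \in l).
  apply/flattenP/andP => [[_ /mapP[e el ->]]|[zL pl]].
    by rewrite mem_fib => /andP[/eqP -> ->].
  by exists (fib eproj L (eproj z)); [apply: map_f | rewrite mem_fib eqxx].
have uL' : uniq L'.
  rewrite /L'; elim: (l) ul => //= e l' IH /andP[el ul'].
  rewrite cat_uniq filter_uniq // IH // andbT; apply/hasPn => z /flattenP[_ /mapP[e' el' ->]].
  rewrite !mem_fib => /andP[/eqP pz _]; apply/negP => /andP[/eqP pz' _].
  by move: el; rewrite -pz' pz el'.
have LE' e : e \in L' -> is_edge g S e by rewrite memL' => /andP[/LE].
pose F (f : set G -> bool) := `[< exists e, W e /\ all f e >].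
(* Edges outside the box are closed by default, so an open projected path must use edges of [l]. *)
pose f0 : set (set G) -> bool := fun=> false.
have [mA PA] := joint_law bX F (f0 \o eproj) uL' LE'.
exists [set w | F (override X L' w (f0 \o eproj))]; split => //.
  rewrite PA lee_fin; apply: le_trans (clutter p0 p1 uL W_inj W_sub f0 ul).
  pose C f v v' := reach (step g S K f) (coset (pt v)) (coset (pt v')).
  have := @grid_percolation _ Es (4 * n) (8 * n) _ size_Es Es_overlap _ p r p0 p1 r0 r1 pr nr C.
  rewrite muln_gt0 n_gt0 => /(_ isT).
  have C1 f v : C f v v by apply: reach_refl.
  have C2 f v v' : C f v v' -> C f v' v by apply: reach_sym => A B; apply: step_sym.
  have C3 f v v' v'' : C f v v' -> C f v' v'' -> C f v v'' by apply: reach_trans.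
  move=> /(_ C1 C2 C3 reach_right reach_up k f0) h; apply: le_trans h _.
  apply: bexp_le_on => // f Hf; rewrite ler_nat.
  case: asboolP => // -[v [kv]]; rewrite /C => hr.
  have e1 : pt (0, 0)%N = gone g by rewrite /pt /= gE.
  rewrite e1 in hr.
  have [q [hq lq]] := reach_path hr.
  (* Shortening makes the connection self-avoiding, as the lift requires. *)
  move: lq; case/shortenP: hq => q' hq' uq' _ lq'.
  case: asboolP => // -[].
  have [t [h1 h2 h3 h4 h5]] := lift_path sK hq' uq'.
  have ut : uniq (map eproj (gpath (gone g) t)) by rewrite h3; apply: pedges_uniq.
  exists (gpath (gone g) t); split; last first.
    by rewrite -all_map h3.
  exists t; split => //.
    move=> e; rewrite h3 => /(allP h4) fe; apply: contraT => /Hf.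
    by rewrite fe.
  by exists v => //; rewrite -[wprod g t](gmul1x g) -h5 lq'.
move=> w /asboolP[e [[t [[ht t1] -> ut st [v kv ev]]] ho]].
exists (wprod g t), v; split => //.
rewrite -[X in reach _ _ X](gmul1x g); apply: gpath_open => //.
  exact: (state_edge bX).
have We : W (gpath (gone g) t) by exists t; split => //; exists v.
apply/allP => z zt; have := allP ho z zt; rewrite /override memL' (W_sub _ We z zt).
by rewrite st // map_f.
Qed.

End GridInSchreierGraph.

(** * The percolation bound with explicit constants *)

Theorem theorem3p18 :
  forall n : nat, (1 <= n)%N ->
  exists eps : Rdefinitions.R, 0 < eps /\
  forall (G : Type) (g : group_struct G) (S : seq G),
    generates g S ->
    infinite_group G ->
    ~ virtually_cyclic g ->
    (exists H : G -> Prop, is_subgroup g H /\ nilpotent g H /\ index_le g H n) ->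
    forall p : Rdefinitions.R, 1 - eps < p -> p <= 1 ->
    forall (d : measure_display) (T : measurableType d) (P : probability T Rdefinitions.R)
      (X : G -> G -> T -> bool),
      bernoulli_bond_perc g S p P X ->
      ~ all_clusters_finite_as g S P X.
Proof.
move=> n n_gt0.
(* With [M = 4 * n] and [K = 8 * n] in the grid estimate, [81 * M * r] equals 1/4, and [r ^+ K]
   serves as [eps]. *)
pose m := (81 * (4 * n) * 4)%N.
have m_gt0 : (0 < m)%N by rewrite /m; lia.
pose r : Rdefinitions.R := m%:R^-1.
have r_gt0 : 0 < r by rewrite invr_gt0 ltr0n.
have r_le1 : r <= 1 by rewrite invf_le1 ?ler1n ?ltr0n.
have nr : (81 * (4 * n))%:R * r <= 4%:R^-1.
  have e : m%:R = (81 * (4 * n))%:R * 4%:R :> Rdefinitions.R by rewrite -natrM.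
  rewrite /r e invfM mulrA divff ?mul1r //.
  by rewrite pnatr_eq0; lia.
exists (r ^+ (8 * n)); split; first exact: exprn_gt0.
move=> G g S gS _ nvc [H [sH [nH iH]]] p pr p1 d T P X bX [N [mN [PN fin]]].
have p0 : 0 <= p.
  have : r ^+ (8 * n) <= 1 by apply: exprn_ile1 => //; apply: ltW.
  by move: pr; move: (r ^+ _) => z; lra.
have [wx [wy [[wxS wxn] [wyS wyn] Hx Hy ind]]] := independent_words n_gt0 gS nvc sH nH iH.
have pr' : 1 - p <= r ^+ (8 * n) by move: pr; move: (r ^+ _) => z; lra.
have ev k := far_event sH wxS wyS wxn wyn Hx Hy ind n_gt0 p0 p1 (ltW r_gt0) r_le1 pr' nr bX k.
have [A hA] := choice ev.
have half_gt0 : 0 < (2%:R^-1 : Rdefinitions.R) by rewrite invr_gt0 ltr0n.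
have [||w [Nw io]] := @infinitely_often_off_null _ _ _ P A N 2%:R^-1 _ mN PN half_gt0.
- by move=> k; case: (hA k).
- by move=> k; case: (hA k).
have [L hL] := fin w Nw (gone g).
(* A finite cluster meets finitely many cosets, each belonging to at most one grid point, so the
   first coordinates reached are bounded. *)
have [b hb] : exists b, forall u v, List.In u L ->
    coset g (lcs g H 1) u = coset g (lcs g H 1) (pt g wx wy v) -> (v.1 < b)%N.
  elim: L {hL} => [|u L [b hb]]; first by exists 0%N.
  case: (pselect (exists v, coset g (lcs g H 1) u = coset g (lcs g H 1) (pt g wx wy v))).
    case=> v ev0; exists (maxn v.1.+1 b) => u' v' [<-|uL] e; last first.
      by rewrite leq_max (hb u') ?orbT.
    suff -> : v' = v by rewrite leq_max ltnSn.
    apply: (pt_inj sH ind (t := gone g)); rewrite !gmulx1; by rewrite -e -ev0.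
  by move=> no; exists b => u' v' [<-|uL] e; [case: no; exists v' | apply: hb uL e].
have [k bk Ak] := io b.
have [_ _ /(_ w Ak) [u [v [hu kv euv]]]] := hA k.
have := hb u v (hL u hu) euv; lia.
Qed.
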